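(* Let $c_2=0$, let $\phi\in S_h^1(D)$ and let $\mathbf x_k\in\mathfrak S(\phi)$ be fixed. Let $V^{(k)}$ be the vector field on $\partial\Omega(\phi)\cap D$ that corresponds to a perturbation of the value of $\phi$ at the node $\mathbf x_k$. Then the discretized boundary shape derivative satisfies $$dg(\Omega(\phi))(V^{(k)})=c_1\sum_{l\in C_k}d_ka_l,$$ where, with $\phi_{l_j}=\phi(\mathbf x_{l_j})$, $$d_ka_l=\pm\frac{|\det J_l|\,\phi_{l_1}[\phi_{l_1}(\phi_{l_2}+\phi_{l_3})-2\phi_{l_2}\phi_{l_3}]}{2(\phi_{l_1}-\phi_{l_2})^2(\phi_{l_1}-\phi_{l_3})^2}\ \ (l\in I_{\mathbf x_k}^{A_\pm}),$$ $$d_ka_l=\mp\frac{|\det J_l|}{2}\frac{\phi_{l_2}^2}{(\phi_{l_2}-\phi_{l_3})(\phi_{l_2}-\phi_{l_1})^2}\ \ (l\in I_{\mathbf x_k}^{B_\pm}),\qquad d_ka_l=\mp\frac{|\det J_l|}{2}\frac{\phi_{l_3}^2}{(\phi_{l_3}-\phi_{l_2})(\phi_{l_3}-\phi_{l_1})^2}\ \ (l\in I_{\mathbf x_k}^{C_\pm}).$$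
   Context: **Mesh.** $D\subset\mathbb R^2$ is a bounded polygonal domain with a conforming finite element mesh with nodes $\mathbf x_1,\dots,\mathbf x_M$ and (open) triangles $\tau_1,\dots,\tau_N$. $I_{\mathbf x_k}=\{l:\mathbf x_k\in\bar\tau_l\}$; $R_{\mathbf x_k}=\{i:\exists l\in I_{\mathbf x_k},\ \mathbf x_i\in\bar\tau_l\}$. $S_h^1(D)$ is the space of continuous functions that are affine on each triangle, with hat basis $\varphi_i(\mathbf x_j)=\delta_{ij}$. For $l\in I_{\mathbf x_k}$ the vertices of $\tau_l$ are $\mathbf x_{l_1},\mathbf x_{l_2},\mathbf x_{l_3}$ in counter-clockwise order with $l_1=k$, and $J_l=[\mathbf x_{l_2}-\mathbf x_{l_1},\ \mathbf x_{l_3}-\mathbf x_{l_1}]$. **Level sets.** For $\phi\in S_h^1(D)$, $\Omega(\phi)$ is the set where $\phi<0$ ($\phi>0$ on $D\setminus\overline{\Omega(\phi)}$ and $\phi=0$ on $\partial\Omega(\phi)\cap D$). $\mathfrak S(\phi)$ is the set of nodes $\mathbf x_k$ for which neither $\phi(\mathbf x_i)\le0$ for all $i\in R_{\mathbf x_k}$ nor $\phi(\mathbf x_i)\ge0$ for all $i\in R_{\mathbf x_k}$. For $\mathbf x_k\in\mathfrak S(\phi)$, $S_{k,\varepsilon}\phi=\phi+\varepsilon\varphi_k$; $C_k=\{l\in I_{\mathbf x_k}:\tau_l\cap\partial\Omega(S_{k,\varepsilon}\phi)\neq\emptyset\}$ for all small $\varepsilon>0$. With $\tilde\phi_{l_j}=(S_{k,\varepsilon}\phi)(\mathbf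 x_{l_j})$, $\varepsilon>0$ small, $l\in I_{\mathbf x_k}$ belongs to $I^{A_+}_{\mathbf x_k}$, $I^{B_+}_{\mathbf x_k}$, $I^{C_+}_{\mathbf x_k}$, $I^{A_-}_{\mathbf x_k}$, $I^{B_-}_{\mathbf x_k}$, $I^{C_-}_{\mathbf x_k}$ if the signs of $(\tilde\phi_{l_1},\tilde\phi_{l_2},\tilde\phi_{l_3})$ are respectively $(+,-,-)$, $(-,+,-)$, $(-,-,+)$, $(-,+,+)$, $(+,-,+)$, $(+,+,-)$ (strict). Standing assumption: $C_k$ is the disjoint union of these six sets. Upper/lower signs in the claim correspond to the superscripts $+$/$-$. **The vector field $V^{(k)}$.** For points $\mathbf p,\mathbf q$ and values $a,b$ put $\mathbf y(\mathbf p,\mathbf q,a,b)=\mathbf p-\frac{a}{b-a}(\mathbf q-\mathbf p)$ (root of the linear interpolant). In each $\tau_l$, $l\in C_k$, the interface of $S_{k,\varepsilon}\phi$ is parametrized by $s\in[0,1]$ via $p^A[\varepsilon](s)=(1-s)\mathbf y(\mathbf x_{l_1},\mathbf x_{l_2},\phi_{l_1}+\varepsilon,\phi_{l_2})+s\,\mathbf y(\mathbf x_{l_1},\mathbf x_{l_3},\phi_{l_1}+\varepsilon,\phi_{l_3})$ for $A_\pm$, $p^B[\varepsilon](s)=(1-s)\mathbf y(\mathbf x_{l_2},\mathbf x_{l_1},\phi_{l_2},\phi_{l_1}+\varepsilon)+s\,\mathbf y(\mathbf x_{l_2},\mathbf x_{l_3},\phi_{l_2},\phi_{l_3})$ for $B_\pm$,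 $p^C[\varepsilon](s)=(1-s)\mathbf y(\mathbf x_{l_3},\mathbf x_{l_1},\phi_{l_3},\phi_{l_1}+\varepsilon)+s\,\mathbf y(\mathbf x_{l_3},\mathbf x_{l_2},\phi_{l_3},\phi_{l_2})$ for $C_\pm$. On $\tau_l\cap\partial\Omega(\phi)$, $V^{(k)}$ at the point $p[0](s)$ is $\frac{d}{d\varepsilon}p[\varepsilon](s)|_{\varepsilon=0}$; $V^{(k)}$ vanishes on the rest of the interface. **Discretized shape derivative.** For the functional with weights $c_1$ (volume) and $c_2$ (tracking term), $dg(\Omega(\phi))(V^{(k)})$ denotes the boundary (Hadamard) formula $\int_{\partial\Omega(\phi)}L\,(V^{(k)}\cdot n)\,dS_x$ with $n$ the unit normal pointing out of $\Omega(\phi)$. For $c_2=0$ (pure volume cost $c_1|\Omega|$) the adjoint vanishes and $L=c_1$. *)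

(* Defs.v *)
From HB Require Import structures.
From mathcomp Require Import all_boot all_order all_algebra.
From mathcomp Require Import all_classical all_reals all_analysis.

Set Implicit Arguments.
Unset Strict Implicit.
Unset Printing Implicit Defensive.

Import Order.TTheory GRing.Theory Num.Theory.
Import numFieldNormedType.Exports.

Local Open Scope classical_set_scope.
Local Open Scope ring_scope.

(* Points of the plane are column vectors. The topology of ['cV[R]_2] is the
   usual one, but its library norm is the sup norm, hence [enorm]. *)
Section plane.
Variable R : realType.
Implicit Types x y : 'cV[R]_2.

Definition dotv x y : R := \sum_i x i 0 * y i 0.

Definition enorm x : R := Num.sqrt (dotv x x).

Definition boundary (A : set 'cV[R]_2) : set 'cV[R]_2 :=
  closure A `\` interior A.

Definition segment x y : set 'cV[R]_2 :=
  [set (1 - t) *: x + t *: y | t in `[0, 1]].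

End plane.

(* One-dimensional Hausdorff measure of the plane (arc length), first as an
   outer measure; [hausdorff1] is the measure it induces on the
   Caratheodory-measurable sets. *)
Section hausdorff.
Variable R : realType.
Local Open Scope ereal_scope.

(* 0 is added to the set so that [ediam set0 = 0]. *)
Definition ediam (A : set 'cV[R]_2) : \bar R :=
  ereal_sup (0 |` [set (enorm (p.1 - p.2))%:E | p in A `*` A]).

Definition hausdorff1_pre (delta : R) (A : set 'cV[R]_2) : \bar R :=
  ereal_inf [set \sum_(k <oo) ediam (U k) | U in
    [set U : (set 'cV[R]_2)^nat |
      (forall k, ediam (U k) <= delta%:E) /\ A `<=` \bigcup_k U k]].

Definition hausdorff1_outer (A : set 'cV[R]_2) : \bar R :=
  ereal_sup [set hausdorff1_pre delta A | delta in [set d : R | (0 < d)%R]].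

Lemma ediam_ge0 A : 0 <= ediam A.
Proof. by apply: ereal_sup_ubound; left. Qed.

Lemma ediam0 : ediam set0 = 0.
Proof.
apply/eqP; rewrite eq_le ediam_ge0 andbT.
by apply: ge_ereal_sup => _ [->//|[p [[]]]].
Qed.

Let weight (delta : R) (A : set (g_sigma_algebraType [set: set 'cV[R]_2])) :=
  if ediam A <= delta%:E then ediam A else +oo.

Let weight_ge0 delta A : 0 <= weight delta A.
Proof. by rewrite /weight; case: ifP => // _; exact: ediam_ge0. Qed.

Let weight0 delta : (0 < delta)%R -> weight delta set0 = 0.
Proof. by move=> d0; rewrite /weight ediam0 lee_fin ltW. Qed.

Let hausdorff1_preE delta : hausdorff1_pre delta = mu_ext (weight delta).
Proof.
apply/funext => A; apply/eqP; rewrite eq_le; apply/andP; split.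
  apply: le_ereal_inf_tmp => _ [U [mU AU] <-].
  have [Ud|] := pselect (forall k, ediam (U k) <= delta%:E).
    apply: ereal_inf_lbound; exists U => //.
    by apply: eq_eseriesr => k _; rewrite /weight Ud.
  move=> /existsNP[k /negP/negbTE Uk].
  rewrite [leRHS](eseries_pinfty (k := k)) ?leey//.
    by move=> n _; rewrite -ltNye (lt_le_trans _ (weight_ge0 _ _)).
  by rewrite /weight Uk.
apply: le_ereal_inf_tmp => _ [U [Ud AU] <-].
apply: ereal_inf_lbound; exists U.
  by split => // k; apply: sub_sigma_algebra.
by apply: eq_eseriesr => k _; rewrite /weight Ud.
Qed.

Let hausdorff1_pre_ge0 delta A : 0 <= hausdorff1_pre delta A.
Proof. by rewrite hausdorff1_preE; apply: mu_ext_ge0 => ?; exact: weight_ge0. Qed.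

Let hausdorff1_outer0 : hausdorff1_outer set0 = 0.
Proof.
rewrite /hausdorff1_outer (_ : image _ _ = [set 0]) ?ereal_sup1//.
apply/seteqP; split => [_ [d d0 <-]|_ ->].
  rewrite /= hausdorff1_preE mu_ext0//; exact: weight0.
exists 1%R; first exact: ltr01.
rewrite hausdorff1_preE mu_ext0//; exact: weight0.
Qed.

Let hausdorff1_outer_ge0 A : 0 <= hausdorff1_outer A.
Proof.
apply: (le_trans (hausdorff1_pre_ge0 1 A)).
by apply: ereal_sup_ubound; exists 1%R; first exact: ltr01.
Qed.

Let le_hausdorff1_outer :
  {homo hausdorff1_outer : A B / A `<=` B >-> A <= B}.
Proof.
move=> A B AB; apply: ge_ereal_sup => _ [d d0 <-].
apply: (@le_trans _ _ (hausdorff1_pre d B)).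
  by rewrite hausdorff1_preE; exact: le_mu_ext.
by apply: ereal_sup_ubound; exists d.
Qed.

Let hausdorff1_outer_sigma_subadditive : sigma_subadditive hausdorff1_outer.
Proof.
move=> F; apply: ge_ereal_sup => _ [d d0 <-].
apply: (@le_trans _ _ (\sum_(k <oo) hausdorff1_pre d (F k))).
  rewrite hausdorff1_preE.
  by apply: (mu_ext_sigma_subadditive (weight_ge0 d)).
apply: lee_nneseries => [k _ _|k _].
  exact: hausdorff1_pre_ge0.
by apply: ereal_sup_ubound; exists d.
Qed.

HB.instance Definition _ := isOuterMeasure.Build R 'cV[R]_2 hausdorff1_outer
  hausdorff1_outer0 hausdorff1_outer_ge0 le_hausdorff1_outer
  hausdorff1_outer_sigma_subadditive.

Definition hausdorff1_om : {outer_measure set 'cV[R]_2 -> \bar R} :=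
  hausdorff1_outer.

Definition hausdorff1 :
    {measure set (caratheodory_type hausdorff1_om) -> \bar R} :=
  hausdorff1_om : set (caratheodory_type hausdorff1_om) -> \bar R.

End hausdorff.

Section shape_derivative.
Variable R : realType.
Implicit Types (O : set 'cV[R]_2) (x n : 'cV[R]_2).

(* [n] is the unit outward normal of [O] at [x]: near [x], up to angles that
   tend to 0, [O] is the half-plane [(y - x) . n < 0]. *)
Definition is_outward_normal O x n : Prop :=
  enorm n = 1 /\
  forall eta : R, 0 < eta -> \forall y \near x,
    (dotv (y - x) n < - eta * enorm (y - x) -> O y) /\
    (eta * enorm (y - x) < dotv (y - x) n -> ~ O y).

(* 0 where there is no normal (e.g. at corners). *)
Definition outward_normal O x : 'cV[R]_2 := xget 0 (is_outward_normal O x).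

(* The boundary formula, with density [L]. An equality of this extended real
   with a real number entails that the integral is finite. *)
Definition shape_derivative (L : 'cV[R]_2 -> R) O
    (V : 'cV[R]_2 -> 'cV[R]_2) : \bar R :=
  (\int[@hausdorff1 R]_(x in boundary O)
     (L x * dotv (V x) (outward_normal O x))%:E)%E.

End shape_derivative.

Section mesh.
Variable R : realType.

(* Bounded, open, connected, with a boundary made of finitely many segments. *)
Definition bounded_polygonal_domain (D : set 'cV[R]_2) : Prop :=
  [/\ open D, connected D, D !=set0, bounded_set D &
    exists s : seq ('cV[R]_2 * 'cV[R]_2),
      boundary D = \bigcup_(p in [set` s]) segment p.1 p.2].

Definition hull M (x : 'I_M -> 'cV[R]_2) (P : set 'I_M) : set 'cV[R]_2 :=
  [set y | exists w : 'I_M -> R,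
    [/\ forall i, 0 <= w i, forall i, ~ P i -> w i = 0,
        \sum_i w i = 1 & y = \sum_i w i *: x i]].

Definition open_triangle (p : 'I_3 -> 'cV[R]_2) : set 'cV[R]_2 :=
  [set y | exists w : 'I_3 -> R,
    [/\ forall i, 0 < w i, \sum_i w i = 1 & y = \sum_i w i *: p i]].

Definition edge_mx (p1 p2 p3 : 'cV[R]_2) : 'M[R]_2 :=
  row_mx (p2 - p1) (p3 - p1).

(* [vertex l] lists the vertices of the [l]-th triangle counter-clockwise,
   starting from an arbitrary one. *)
Record mesh (D : set 'cV[R]_2) (M N : nat) := Mesh {
  node : 'I_M -> 'cV[R]_2 ;
  vertex : 'I_N -> 'I_3 -> 'I_M ;
  tau := fun l => open_triangle (node \o vertex l) ;
  node_inj : injective node ;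
  vertex_ccw : forall l, 0 < \det (edge_mx (node (vertex l 0))
    (node (vertex l 1)) (node (vertex l 2))) ;
  node_vertex : forall i, exists l j, vertex l j = i ;
  mesh_sub : forall l, tau l `<=` D ;
  mesh_cover : closure D = \bigcup_l closure (tau l) ;
  mesh_disjoint : forall l m : 'I_N, l != m -> tau l `&` tau m = set0 ;
  mesh_conforming : forall l m, closure (tau l) `&` closure (tau m) =
    hull node (range (vertex l) `&` range (vertex m))
}.

Section mesh_theory.
Variables (D : set 'cV[R]_2) (M N : nat) (T : mesh D M N).
Implicit Types (phi : 'cV[R]_2 -> R) (hat : 'I_M -> 'cV[R]_2 -> R).
Implicit Types (k i : 'I_M) (l : 'I_N).

(* I_{x_k} *)
Definition star k : {set 'I_N} :=
  [set l | `[< closure (tau T l) (node T k) >]]%SET.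

(* R_{x_k} *)
Definition neighbours k : {set 'I_M} :=
  [set i | [exists l in star k, `[< closure (tau T l) (node T i) >]]]%SET.

(* S_h^1(D). Elements are functions on the plane; the values outside the closure of D are irrelevant. *)
Definition S1h phi : Prop :=
  {within closure D, continuous phi} /\
  forall l, exists (a : 'cV[R]_2) (b : R),
    forall x, tau T l x -> phi x = dotv a x + b.

Definition hat_basis hat : Prop :=
  forall i, S1h (hat i) /\ forall j, hat i (node T j) = (i == j)%:R.

(* l_1, l_2, l_3 (as [lv k l 0], [lv k l 1], [lv k l 2]) for [l] in
   [star k]: the rotation of [vertex l] that starts at [k]. *)
Definition lv k l (j : 'I_3) : 'I_M :=
  vertex T l (odflt 0 [pick i | vertex T l i == k] + j).

Definition lx k l j : 'cV[R]_2 := node T (lv k l j).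

Definition lphi phi k l j : R := phi (lx k l j).

Definition J k l : 'M[R]_2 := edge_mx (lx k l 0) (lx k l 1) (lx k l 2).

(* Omega(phi) *)
Definition Omega phi : set 'cV[R]_2 := [set x | D x /\ phi x < 0].

(* x_k is in frak S(phi) *)
Definition cut_node phi k : Prop :=
  ~ (forall i, i \in neighbours k -> phi (node T i) <= 0) /\
  ~ (forall i, i \in neighbours k -> 0 <= phi (node T i)).

(* S_{k, eps} phi *)
Definition perturb hat k (eps : R) phi : 'cV[R]_2 -> R :=
  fun x => phi x + eps * hat k x.

(* C_k *)
Definition cut_cells hat phi k : {set 'I_N} :=
  [set l in star k | `[< \forall eps \near 0^'+,
    tau T l `&` boundary (Omega (perturb hat k eps phi)) !=set0 >]]%SET.

Definition sign_cells hat phi k (s : 'I_3 -> R) : {set 'I_N} :=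
  [set l in star k | `[< \forall eps \near 0^'+, forall j,
    Num.sg (lphi (perturb hat k eps phi) k l j) = s j >]]%SET.

(* I^{A_+}, I^{B_+}, I^{C_+} for [s = 1] and [j = 0, 1, 2];
   I^{A_-}, I^{B_-}, I^{C_-} for [s = -1]: the [j]-th sign is [s], the other
   two are [- s]. *)
Definition IABC hat phi k (j : 'I_3) (s : R) : {set 'I_N} :=
  sign_cells hat phi k (fun j' => if j' == j then s else - s).

Definition IA hat phi k := IABC hat phi k 0.
Definition IB hat phi k := IABC hat phi k 1.
Definition IC hat phi k := IABC hat phi k 2.

Definition IABC_seq hat phi k : seq {set 'I_N} :=
  [:: IA hat phi k 1; IB hat phi k 1; IC hat phi k 1;
      IA hat phi k (-1); IB hat phi k (-1); IC hat phi k (-1)].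

(* C_k is the disjoint union of the six sets. *)
Definition standing_assumption hat phi k : Prop :=
  cut_cells hat phi k = (\bigcup_(A <- IABC_seq hat phi k) A)%SET /\
  pairwise (fun A B : {set 'I_N} => (A :&: B)%SET == finset.set0) (IABC_seq hat phi k).

Definition root_pt (p q : 'cV[R]_2) (a b : R) : 'cV[R]_2 :=
  p - (a / (b - a)) *: (q - p).

Definition pA phi k l (eps s : R) : 'cV[R]_2 :=
  let x := lx k l in let f := lphi phi k l in
  (1 - s) *: root_pt (x 0) (x 1) (f 0 + eps) (f 1) +
  s *: root_pt (x 0) (x 2) (f 0 + eps) (f 2).

Definition pB phi k l (eps s : R) : 'cV[R]_2 :=
  let x := lx k l in let f := lphi phi k l in
  (1 - s) *: root_pt (x 1) (x 0) (f 1) (f 0 + eps) +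
  s *: root_pt (x 1) (x 2) (f 1) (f 2).

Definition pC phi k l (eps s : R) : 'cV[R]_2 :=
  let x := lx k l in let f := lphi phi k l in
  (1 - s) *: root_pt (x 2) (x 0) (f 2) (f 0 + eps) +
  s *: root_pt (x 2) (x 1) (f 2) (f 1).

(* Only used for [l] in the union of the six sets. *)
Definition param hat phi k l : R -> R -> 'cV[R]_2 :=
  if l \in (IA hat phi k 1 :|: IA hat phi k (-1))%SET then pA phi k l
  else if l \in (IB hat phi k 1 :|: IB hat phi k (-1))%SET then pB phi k l
  else pC phi k l.

(* V^{(k)}; [xget 0] makes it vanish off the parametrized interface. On it the
   value is unique, as the open triangles are disjoint and [p[0]] is injective
   as soon as it meets one of them. *)
Definition Vk hat phi k (x : 'cV[R]_2) : 'cV[R]_2 :=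
  xget 0 [set v : 'cV[R]_2 | exists (l : 'I_N) (s : R),
    [/\ l \in cut_cells hat phi k,
        (tau T l `&` boundary (Omega phi)) x,
        0 <= s <= 1,
        x = param hat phi k l 0 s &
        v = derive1 (fun eps => param hat phi k l eps s) 0]].

(* [dA], [dB], [dC]: d_k a_l without the leading sign. *)
Definition dA phi k l : R :=
  let f := lphi phi k l in
  `|\det (J k l)| *
    (f 0 * (f 0 * (f 1 + f 2) - 2 * f 1 * f 2)) /
    (2 * (f 0 - f 1) ^+ 2 * (f 0 - f 2) ^+ 2).

Definition dB phi k l : R :=
  let f := lphi phi k l in
  `|\det (J k l)| / 2 * (f 1 ^+ 2 / ((f 1 - f 2) * (f 1 - f 0) ^+ 2)).

Definition dC phi k l : R :=
  let f := lphi phi k l in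
  `|\det (J k l)| / 2 *
    (f 2 ^+ 2 / ((f 2 - f 1) * (f 2 - f 0) ^+ 2)).

(* d_k a_l *)
Definition dka hat phi k l : R :=
  if l \in IA hat phi k 1 then dA phi k l
  else if l \in IA hat phi k (-1) then - dA phi k l
  else if l \in IB hat phi k 1 then - dB phi k l
  else if l \in IB hat phi k (-1) then dB phi k l
  else if l \in IC hat phi k 1 then - dC phi k l
  else if l \in IC hat phi k (-1) then dC phi k l
  else 0.

End mesh_theory.
End mesh.

(* Main.v *)
(** In each cut cell the interface is the open segment between the roots of [phi]
    on two edges, [phi] is affine with gradient [a] there, and the normal is
    [a / |a|]. Along the segment [V . n] is affine in the parameter [s], so its
    integral is its mean value times the length of the segment; since
    [(V at an edge root) . a] is a rational function of the nodal values and
    [length / |a| = |v0 det J / ((v1 - v0) (v2 - v0))|], with [v0] the nodal value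
    of isolated sign, the gradient cancels and [d_k a_l] remains. The integral
    against the Hausdorff measure reduces to a Lebesgue integral: half-planes are
    Caratheodory measurable because the measure is additive on separated sets, and
    on a line the Hausdorff measure of an interval is its length. *)

Require Import Defs.
From mathcomp Require Import all_boot all_order all_algebra.
From mathcomp Require Import all_classical all_reals all_analysis.
From mathcomp Require Import measurable_realfun ring lra.
Set Implicit Arguments.
Unset Strict Implicit.
Unset Printing Implicit Defensive.
Import Order.TTheory GRing.Theory Num.Theory.
Import numFieldNormedType.Exports.
Local Open Scope classical_set_scope.
Local Open Scope ring_scope.

(** * Hausdorff measure on lines *)

(** The six sign patterns are one computation: the vertices are reordered so that the one of
    isolated sign comes first, and the rates [m0], [m1], [m2] record which of them is perturbed. The
    leading sign of [d_k a_l] is then the sign of the isolated nodal value, because the denominator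
    in the length of the segment is positive.

    The obstacle is that the signs are strict only after the perturbation: [phi] itself may vanish
    at the perturbed node. In the patterns B_- and C_- this merely moves one end of the segment to
    that node, so one of the sign hypotheses has to be weak. In the pattern A_+ the isolated value
    itself is zero; the interface then leaves the open triangle, and both the integral and the
    formula are 0.

    [Vk] is nonzero only inside open triangles. Hence the integrand is a finite sum of functions,
    each carried by one cell and extended by 0 to the plane; integrability is proved cell by cell,
    and this is what lets the sum and the integral be exchanged. *)

Section plane_geometry.
Context {R : realType}.
Implicit Types x y z u : 'cV[R]_2.

Lemma dotvE x y : dotv x y = x 0 0 * y 0 0 + x 1 0 * y 1 0.
Proof.
rewrite /dotv !big_ord_recl big_ord0 addr0.
by have -> : lift ord0 ord0 = 1 :> 'I_2 by exact/val_inj.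
Qed.

Lemma dotvC x y : dotv x y = dotv y x.
Proof. by rewrite !dotvE; ring. Qed.

Lemma dotvDl x y z : dotv (x + y) z = dotv x z + dotv y z.
Proof. by rewrite !dotvE !mxE; ring. Qed.

Lemma dotvDr x y z : dotv x (y + z) = dotv x y + dotv x z.
Proof. by rewrite !dotvE !mxE; ring. Qed.

Lemma dotvBl x y z : dotv (x - y) z = dotv x z - dotv y z.
Proof. by rewrite !dotvE !mxE; ring. Qed.

Lemma dotvBr x y z : dotv x (y - z) = dotv x y - dotv x z.
Proof. by rewrite !dotvE !mxE; ring. Qed.

Lemma dotvZl a x y : dotv (a *: x) y = a * dotv x y.
Proof. by rewrite !dotvE !mxE; ring. Qed.

Lemma dotvZr a x y : dotv x (a *: y) = a * dotv x y.
Proof. by rewrite !dotvE !mxE; ring. Qed.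

Lemma dot0v x : dotv 0 x = 0.
Proof. by rewrite !dotvE !mxE; ring. Qed.

Lemma dotvv_ge0 x : 0 <= dotv x x.
Proof. by rewrite dotvE addr_ge0// -expr2 sqr_ge0. Qed.

Lemma enorm_ge0 x : 0 <= enorm x.
Proof. exact: sqrtr_ge0. Qed.

Lemma enorm_sqr x : enorm x ^+ 2 = dotv x x.
Proof. by rewrite /enorm sqr_sqrtr ?dotvv_ge0. Qed.

Lemma dotvv_gt0 x : x != 0 -> 0 < dotv x x.
Proof.
move=> x0; rewrite lt_def dotvv_ge0 andbT; apply: contra x0 => /eqP.
rewrite dotvE => /eqP; rewrite paddr_eq0 -?expr2 ?sqr_ge0// !sqrf_eq0.
move=> /andP[/eqP x00 /eqP x10]; apply/eqP/colP => i; rewrite mxE.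
have [->//|/eqP i0] := eqVneq i 0.
by have -> : i = 1 by apply/val_inj; case: i i0 => -[|[|//]] // i; case; exact/val_inj.
Qed.

Lemma enorm_gt0 x : x != 0 -> 0 < enorm x.
Proof. by move=> x0; rewrite sqrtr_gt0 dotvv_gt0. Qed.

Lemma enormZ a x : enorm (a *: x) = `|a| * enorm x.
Proof.
by rewrite /enorm dotvZl dotvZr mulrA -expr2 sqrtrM ?sqr_ge0// sqrtr_sqr.
Qed.

Lemma cauchy_schwarz x y : `|dotv x y| <= enorm x * enorm y.
Proof.
rewrite -(ler_pXn2r (n := 2)) ?nnegrE ?mulr_ge0 ?enorm_ge0//.
rewrite exprMn !enorm_sqr real_normK ?num_real// !dotvE -subr_ge0.
set q := (X in 0 <= X).
(* Lagrange's identity: the defect is the square of the determinant. *)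
suff -> : q = (x 0 0 * y 1 0 - x 1 0 * y 0 0) ^+ 2 by exact: sqr_ge0.
by rewrite /q; ring.
Qed.

End plane_geometry.

Section hausdorff_measure.
Context {R : realType}.
Local Notation plane := 'cV[R]_2.
Local Notation H := (@hausdorff1_outer R).
Local Notation Hpre := (@hausdorff1_pre R).
Local Notation ediam := (@ediam R).
Implicit Types (A B X : set plane) (x y u : plane) (f : plane -> R).
Local Open Scope ereal_scope.

Lemma ediam_ub A x y : A x -> A y -> (enorm (x - y))%:E <= ediam A.
Proof. by move=> Ax Ay; apply: ereal_sup_ubound; right; exists (x, y). Qed.

Lemma le_ediam A B : A `<=` B -> ediam A <= ediam B.
Proof.
move=> AB; apply: ge_ereal_sup => _ [->|[p [Ap Bp] <-]]; first exact: ediam_ge0.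
by apply: ediam_ub; exact: AB.
Qed.

Lemma hausdorff1_pre_le delta A (U : (set plane)^nat) :
  (forall k, ediam (U k) <= delta%:E) -> A `<=` \bigcup_k U k ->
  Hpre delta A <= \sum_(k <oo) ediam (U k).
Proof. by move=> Ud AU; apply: ereal_inf_lbound; exists U. Qed.

Lemma hausdorff1_preS d d' A : (d <= d')%R -> Hpre d' A <= Hpre d A.
Proof.
move=> dd'; apply: le_ereal_inf_tmp => _ [U [Ud AU] <-].
by apply: hausdorff1_pre_le => // k; rewrite (le_trans (Ud k))// lee_fin.
Qed.

(** A set of diameter at most [d] cannot meet both sides of a gap wider than [d], because [f] is
    1-Lipschitz. Replacing each [U k] by its traces on [A] and on [B] thus covers both sets at no
    extra cost. *)
Lemma hausdorff1_preU f (a b d : R) A B :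
  (forall x y, `|f x - f y| <= enorm (x - y))%R -> (d < b - a)%R ->
  (forall x, A x -> (f x <= a)%R) -> (forall x, B x -> (b <= f x)%R) ->
  Hpre d A + Hpre d B <= Hpre d (A `|` B).
Proof.
move=> fL dab fA fB; apply: le_ereal_inf_tmp => _ [U [Ud ABU] <-].
have H C : C `<=` A `|` B ->
    Hpre d C <= \sum_(k <oo) ediam (U k `&` C).
  move=> CAB; apply: hausdorff1_pre_le => [k|x Cx].
    exact: (le_trans (le_ediam (@subIsetl _ _ _))).
  by have [k _ Ukx] := ABU _ (CAB _ Cx); exists k.
apply: le_trans (leeD (H A (@subsetUl _ _ _)) (H B (@subsetUr _ _ _))) _.
rewrite -nneseriesD; [|by move=> *; exact: ediam_ge0..].
apply: lee_nneseries => [k _ _|k _].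
  by rewrite adde_ge0// ediam_ge0.
have [->|/set0P[x [Ux Ax]]] := eqVneq (U k `&` A) set0.
  by rewrite ediam0 add0e; apply: le_ediam; exact: subIsetl.
have [->|/set0P[y [Uy By]]] := eqVneq (U k `&` B) set0.
  by rewrite ediam0 adde0; apply: le_ediam; exact: subIsetl.
have := le_trans (ediam_ub Uy Ux) (Ud k); rewrite lee_fin => dyx.
exfalso; have := fL y x; have := fA _ Ax; have := fB _ By.
have := ler_norm (f y - f x)%R; lra.
Qed.

Lemma hausdorff1_sepU f (a b : R) A B :
  (forall x y, `|f x - f y| <= enorm (x - y))%R -> (a < b)%R ->
  (forall x, A x -> (f x <= a)%R) -> (forall x, B x -> (b <= f x)%R) ->
  H A + H B <= H (A `|` B).
Proof.
move=> fL ab fA fB.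
have Hpre_ge0 d C : 0 <= Hpre d C.
  apply: le_ereal_inf_tmp => _ [U _ <-].
  by apply: nneseries_ge0 => k _ _; exact: ediam_ge0.
(* The scales for [A] and [B] are independent, so that the two suprema can be taken one after the
   other. *)
have sumle d1 d2 : (0 < d1)%R -> (0 < d2)%R ->
    Hpre d1 A + Hpre d2 B <= H (A `|` B).
  move=> d10 d20; pose d := Num.min (Num.min d1 d2) ((b - a) / 2)%R.
  have d0 : (0 < d)%R by rewrite !lt_min d10 d20/=; lra.
  apply: (@le_trans _ _ (Hpre d (A `|` B))); last first.
    by apply: ereal_sup_ubound; exists d.
  apply: (@le_trans _ _ (Hpre d A + Hpre d B)).
    by apply: leeD; apply: hausdorff1_preS; rewrite !ge_min lexx ?orbT.
  apply: hausdorff1_preU fL _ fA fB.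
  by apply: (@le_lt_trans _ _ ((b - a) / 2)%R); [rewrite ge_min lexx orbT|lra].
have H0 : 0 <= H (A `|` B) by exact: (@outer_measure_ge0 _ _ (@hausdorff1_om R)).
(* The suprema are taken after moving a term across the inequality, which is possible only between
   finite values. *)
have [->|Hoo] := eqVneq (H (A `|` B)) +oo; first by rewrite leey.
have Hfin : H (A `|` B) \is a fin_num by rewrite ge0_fin_numE// lt_neqAle Hoo leey.
have fin c : 0 <= c -> c <= H (A `|` B) -> c \is a fin_num.
  move=> c0 cH; rewrite ge0_fin_numE// (le_lt_trans cH)//.
  by rewrite -ge0_fin_numE.
have HA d : (0 < d)%R -> H A + Hpre d B <= H (A `|` B).
  move=> d0.
  have fB' : Hpre d B \is a fin_num.
    apply: fin => //; apply: le_trans _ (sumle _ _ d0 d0); exact: leeDr.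
  rewrite -leeBrDr//; apply: ge_ereal_sup => _ [e e0 <-].
  by rewrite leeBrDr//; exact: sumle.
have fHA : H A \is a fin_num.
  apply: fin; first exact: (@outer_measure_ge0 _ _ (@hausdorff1_om R)).
  by apply: (@le_outer_measure _ _ (@hausdorff1_om R)); exact: subsetUl.
rewrite addeC -leeBrDr//; apply: ge_ereal_sup => _ [e e0 <-].
by rewrite leeBrDr// addeC; exact: HA.
Qed.

Local Notation Hom := (@hausdorff1_om R).

(** Caratheodory's criterion for metric outer measures, with the levels of [f] in the role of the
    distance. The part [Z n] of [X] is separated from the sublevel set, so the measure is additive
    on the two. What lies between them is a union of strips [S k]; their measures form a convergent
    series, so the error is a tail that tends to 0. *)
Lemma hausdorff1_sublevel f (c : R) :
  (forall x y, `|f x - f y| <= enorm (x - y))%R ->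
  Hom.-caratheodory [set x | (f x <= c)%R].
Proof.
move=> fL; apply: le_caratheodory_measurable => X.
have [->|Xoo] := eqVneq (Hom X) +oo; first by rewrite leey.
pose r n : R := (c + n.+1%:R^-1)%R.
have rS n : (r n.+1 < r n)%R.
  by rewrite ltrD2l ltf_pV2 ?posrE ?ltr0n// ltr_nat.
pose Z n := X `&` [set x | (r n < f x)%R].
pose S n := X `&` [set x | (r n.+2 < f x <= r n.+1)%R].
have H0 A : 0 <= Hom A by exact: outer_measure_ge0.
have HX A : A `<=` X -> Hom A <= Hom X by exact: le_outer_measure.
(* There is a gap between [S n] and [Z n], but none between consecutive strips;
   hence the two terms of the bound. *)
have Ssum n : \sum_(0 <= k < n) Hom (S k) <= Hom (Z n.+1) + Hom (Z n).
  elim: n => [|n IH]; first by rewrite big_geq// adde_ge0.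
  rewrite big_nat_recr//=; apply: (le_trans (leeD2r _ IH)).
  rewrite -addeA [leRHS]addeC; apply: leeD => //.
  apply: (@le_trans _ _ (Hom (S n `|` Z n))).
    rewrite [X in X <= _]addeC; apply: (hausdorff1_sepU fL (rS n)) => x [_ /=].
      by case/andP.
    exact: ltW.
  apply: le_outer_measure => x [[Xx /=/andP[rx _]]|[Xx /= rx]]; split => //=.
  by rewrite (lt_trans (rS _))// (lt_trans (rS _)).
have Sfin : \sum_(0 <= k <oo) Hom (S k) < +oo.
  apply: (@le_lt_trans _ _ (Hom X + Hom X)).
    apply: lime_le; first exact: is_cvg_nneseries.
    apply: nearW => n; apply: (le_trans (Ssum n)).
    by apply: leeD; apply: HX; exact: subIsetl.
  by rewrite lte_add_pinfty// ltey.
have Stail n : X `&` [set x | (c < f x <= r n.+1)%R] `<=`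
    \bigcup_(k in ~` `I_n) S k.
  move=> x [Xx /= /andP[cx xr]].
  (* The least [m] with [r m < f x] places [x] in the strip of index [m - 2]; the bound
     [f x <= r n.+1] forces this index to be at least [n]. *)
  have /ex_minnP[m mx mmin] : exists m, (r m < f x)%R.
    by have [m mx] := ltr_add_invr cx; exists m.
  have : (n.+1 < m)%N.
    rewrite ltnNge; apply/negP => mn.
    have : (r n.+1 <= r m)%R.
      by rewrite lerD2l lef_pV2 ?posrE ?ltr0n// ler_nat ltnS.
    by move=> /(le_trans xr); rewrite leNgt mx.
  case: m mx mmin => // -[//|m] mx mmin nm.
  exists m; first by move=> /=; apply/negP; rewrite -leqNgt -ltnS -ltnS.
  split => //=; rewrite mx/= leNgt; apply/negP => /mmin.
  by rewrite ltnn.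
have {Stail}Htail n : Hom (X `&` [set x | (c < f x <= r n.+1)%R]) <=
    \sum_(n <= k <oo) Hom (S k).
  apply: le_trans _ (outer_measure_sigma_subadditive_tail _ _ _).
  exact: le_outer_measure.
have main n : Hom (X `&` [set x | (f x <= c)%R]) +
    Hom (X `&` ~` [set x | (f x <= c)%R]) <=
    Hom X + \sum_(n <= k <oo) Hom (S k).
  apply: (@le_trans _ _ (Hom (X `&` [set x | (f x <= c)%R]) +
      (Hom (Z n.+1) + Hom (X `&` [set x | (c < f x <= r n.+1)%R])))).
    apply: leeD => //; apply: le_trans _ (outer_measureU2 _ _ _).
    apply: le_outer_measure => x [Xx /= /negP]; rewrite -ltNge => cx.
    have [rx|xr] := ltP (r n.+1) (f x); [left|right]; split => //=.
    by rewrite cx.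
  rewrite addeA; apply: leeD => //.
  apply: (@le_trans _ _ (Hom ((X `&` [set x | (f x <= c)%R]) `|` Z n.+1))).
    apply: (@hausdorff1_sepU f c (r n.+1)) => //.
    - by rewrite ltrDl invr_gt0.
    - by move=> x [].
    - by move=> x [_ /=]; exact: ltW.
  by apply: HX => x [[]|[]].
have cvX : Hom X + \sum_(n <= k <oo) Hom (S k) @[n --> \oo] --> Hom X + 0.
  apply: cvgeD; [by rewrite fin_num_adde_defl|exact: cvg_cst|].
  exact: nneseries_tail_cvg.
by rewrite -[leRHS]adde0; apply: (cvge_ge _ cvX); apply: nearW => n; exact: main.
Qed.

Lemma measurable_fun_lipschitz f :
  (forall x y, `|f x - f y| <= enorm (x - y))%R ->
  measurable_fun setT (f : caratheodory_type Hom -> R).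
Proof.
move=> fL; apply: (measurability _ (RGenOInfty.measurableE R)) => //.
move=> _ [_ [c ->] <-]; rewrite setTI.
rewrite (_ : _ @^-1` _ = ~` [set x | (f x <= c)%R]).
  by apply: measurableC; exact: hausdorff1_sublevel.
by apply/seteqP; split => x /=; rewrite in_itv/= andbT ltNge => /negP.
Qed.

Definition perp u : plane := \col_i (if i == 0 then - u 1 0 else u 0 0)%R.

Definition abscissa (Y u x : plane) : R := dotv (x - Y) u.

(** For a unit vector [u], the fixed points of the orthogonal projection onto the line; in this form
    a point is rewritten directly from its abscissa. *)
Definition line Y u : set plane := [set x | x = Y + abscissa Y u x *: u]%R.

Lemma abscissa_lipschitz Y u x y : (enorm u = 1 ->
  `|abscissa Y u x - abscissa Y u y| <= enorm (x - y))%R.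
Proof.
move=> u1; rewrite /abscissa -dotvBl opprB addrA subrK -[leRHS]mulr1 -u1.
exact: cauchy_schwarz.
Qed.

Lemma enorm_perp u : enorm (perp u) = enorm u.
Proof. by congr Num.sqrt; rewrite !dotvE !mxE/=; ring. Qed.

Lemma abscissaE Y u s : (enorm u = 1 -> abscissa Y u (Y + s *: u) = s)%R.
Proof.
by move=> u1; rewrite /abscissa addrAC subrr add0r dotvZl -enorm_sqr u1 expr1n mulr1.
Qed.

Lemma line_dist Y u x y : enorm u = 1%R -> line Y u x -> line Y u y ->
  enorm (x - y) = `|abscissa Y u x - abscissa Y u y|%R.
Proof.
move=> u1 -> ->; rewrite !abscissaE// opprD addrACA subrr add0r -scalerBl.
by rewrite enormZ u1 mulr1.
Qed.

Lemma colP2 x y : x 0%R 0%R = y 0%R 0%R -> x 1%R 0%R = y 1%R 0%R -> x = y.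
Proof.
move=> xy0 xy1; apply/colP => i; have [->//|i0] := eqVneq i 0%R.
suff -> : i = 1%R by [].
by apply/val_inj; case: i i0 => -[|[|]].
Qed.

(** A level set of a 1-Lipschitz function, hence measurable. *)
Lemma line_perp Y u : enorm u = 1%R ->
  line Y u = abscissa Y (perp u) @^-1` [set 0%R].
Proof.
move=> u1; have : (u 0 0 ^+ 2 + u 1 0 ^+ 2 = 1)%R.
  by rewrite !expr2 -dotvE -enorm_sqr u1 expr1n.
move=> uE; apply/seteqP; split => x; rewrite /line/= /abscissa.
  by move=> ->; rewrite !dotvE !mxE/=; ring.
rewrite !dotvE !mxE/= => xp; apply: colP2; rewrite !mxE.
  (* Each coordinate equation is a linear combination of [xp] and [uE]: adding the right multiples
     to both sides leaves a ring identity. *)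
  apply: (@addIr _ (u 1 0 * 0)%R); rewrite -[in LHS]xp.
  apply: (@addIr _ ((x 0 0 - Y 0 0) * 1)%R); rewrite -[in LHS]uE; ring.
apply: (@addIr _ (- u 0 0 * 0)%R); rewrite -[in LHS]xp.
apply: (@addIr _ ((x 1 0 - Y 1 0) * 1)%R); rewrite -[in LHS]uE; ring.
Qed.

Lemma measurable_abscissa Y u : enorm u = 1%R ->
  measurable_fun setT (abscissa Y u : caratheodory_type Hom -> R).
Proof.
by move=> u1; apply: measurable_fun_lipschitz => x y; exact: abscissa_lipschitz.
Qed.

Lemma measurable_line Y u : enorm u = 1%R ->
  measurable (line Y u : set (caratheodory_type Hom)).
Proof.
move=> u1; rewrite line_perp// -[X in measurable X]setTI.
apply: measurable_abscissa; rewrite ?enorm_perp//; exact: measurable_set1.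
Qed.

(** The abscissa does not increase distances, so a cover of the segment projects to sets contained
    in intervals [I k] no longer than the diameters, and these cover []a, b]]. Subadditivity of the
    Lebesgue measure concludes. Half-open intervals are those on which [lebesgue_measure_unique]
    compares measures. *)
Lemma hausdorff1_segment_ge Y u (a b : R) : enorm u = 1%R -> (a < b)%R ->
  (b - a)%:E <= H (line Y u `&` abscissa Y u @^-1` `]a, b]).
Proof.
move=> u1 ab.
(* The bound is the same at every scale; scale 1 makes the diameters finite. *)
apply: (@le_trans _ _ (Hpre 1 (line Y u `&` abscissa Y u @^-1` `]a, b]))); last first.
  by apply: ereal_sup_ubound; exists 1%R; first exact: ltr01.
apply: le_ereal_inf_tmp => _ [U [Ud AU] <-].
pose pi := abscissa Y u.
have Ufin k : ediam (U k) \is a fin_num.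
  by rewrite ge0_fin_numE ?ediam_ge0// (le_lt_trans (Ud k))// ltry.
pose I k : set R := if U k == set0 then set0 else
  `[inf (pi @` U k), (inf (pi @` U k) + fine (ediam (U k)))%R]%classic.
have dist k x y : U k x -> U k y -> (pi x <= pi y + fine (ediam (U k)))%R.
  move=> Ux Uy; have := ediam_ub Ux Uy; rewrite -(fineK (Ufin k)) lee_fin.
  have := abscissa_lipschitz Y x y u1; have := ler_norm (pi x - pi y)%R.
  rewrite -/(pi x) -/(pi y); lra.
have UI k : pi @` U k `<=` I k.
  move=> _ [x Ux <-]; rewrite /I ifF; last first.
    by apply/negbTE/set0P; exists x.
  rewrite /= in_itv/=; apply/andP; split.
    apply: ge_inf; last by exists x.
    exists (pi x - fine (ediam (U k)))%R => _ [y Uy <-].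
    by rewrite lerBlDr; exact: dist.
  rewrite -lerBlDr; apply: lb_le_inf; first by exists (pi x), x.
  by move=> _ [y Uy <-]; rewrite lerBlDr; exact: dist.
have mI k : measurable (I k).
  by rewrite /I; case: ifP => _; [exact: measurable0|exact: measurable_itv].
have lI k : lebesgue_measure (I k) <= ediam (U k).
  rewrite /I; case: ifP => _; first by rewrite measure0 ediam_ge0.
  rewrite lebesgue_measure_itv/= lte_fin; case: ifP => _; last exact: ediam_ge0.
  by rewrite -EFinD addrAC subrr add0r fineK.
apply: (@le_trans _ _ (\sum_(k <oo) lebesgue_measure (I k))); last first.
  exact: lee_nneseries.
have -> : (b - a)%:E = lebesgue_measure (`]a, b]%classic : set R).
  by rewrite lebesgue_measure_itv/= lte_fin ab EFinB.
apply: measure_sigma_subadditive => // s; rewrite /= => sab.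
have [] := AU (Y + s *: u)%R.
  by split; rewrite /line/= abscissaE.
move=> k _ Uk; exists k => //; apply: UI.
by exists (Y + s *: u)%R => //; rewrite /pi abscissaE.
Qed.

Lemma hausdorff1_segment_le Y u (a b : R) : enorm u = 1%R -> (a < b)%R ->
  H (line Y u `&` abscissa Y u @^-1` `]a, b]) <= (b - a)%:E.
Proof.
move=> u1 ab; apply: ge_ereal_sup => _ [d /= d0 <-].
(* Enough equal pieces for their length [h] not to exceed the scale [d]. *)
pose N := (Num.truncn ((b - a) / d)).+1.
pose h : R := ((b - a) / N%:R)%R.
have N0 : (0 < N%:R :> R)%R by rewrite ltr0n.
have hN : (h * N%:R = b - a)%R by rewrite /h divfK// gt_eqF.
have h0 : (0 < h)%R by rewrite divr_gt0// subr_gt0.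
have hd : (h <= d)%R.
  rewrite /h ler_pdivrMr// mulrC -ler_pdivrMr//; apply/ltW; exact: truncnS_gt.
pose U k : set plane := if (k < N)%N then
  line Y u `&` abscissa Y u @^-1` `](a + k%:R * h)%R, (a + k.+1%:R * h)%R] else set0.
have Uh k : ediam (U k) <= (if (k < N)%N then h else 0)%:E.
  rewrite /U; case: ifP => kN; last by rewrite ediam0.
  apply: ge_ereal_sup => _ [->|[[x y] /= [[lx /= xI] [ly /= yI]] <-]].
    by rewrite lee_fin ltW.
  move: xI yI; rewrite !in_itv/= => /andP[x1 x2] /andP[y1 y2].
  rewrite lee_fin (line_dist u1 lx ly) ler_norml.
  move: x1 x2 y1 y2; rewrite -!natr1 !mulrDl mul1r; lra.
apply: (le_trans (hausdorff1_pre_le (U := U) _ _)).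
- move=> k; apply: (le_trans (Uh k)); rewrite lee_fin.
  by case: ifP => _ //; exact: ltW.
- move=> x [lx /=]; rewrite in_itv/= => /andP[ax xb].
  (* For the least such [m], the point lies in the piece of index [m - 1]; [m = 0] is excluded
     because the abscissa exceeds [a]. *)
  have /ex_minnP[m mx mmin] : exists m, (abscissa Y u x <= a + m%:R * h)%R.
    by exists N; rewrite mulrC hN; lra.
  have mN : (m <= N)%N by apply: mmin; rewrite mulrC hN; lra.
  case: m mx mmin mN => [|m] mx mmin mN; first by move: mx; lra.
  exists m => //; rewrite /U mN; split => //=; rewrite in_itv/= mx andbT ltNge.
  by apply/negP => /mmin; rewrite ltnn.
rewrite (nneseries_split 0 N); last by move=> *; exact: ediam_ge0.
rewrite [X in _ + X]eseries0 ?adde0; last first.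
  by move=> k; rewrite add0n => kN _; rewrite /U ltnNge kN/= ediam0.
apply: (@le_trans _ _ (\sum_(0 <= k < 0 + N) h%:E)).
  rewrite !big_nat; apply: lee_sum => k /andP[_ kN]; apply: (le_trans (Uh k)).
  by rewrite kN.
by rewrite add0n sumEFin sumr_const_nat subn0 lee_fin -[(h *+ N)%R]mulr_natr hN.
Qed.


End hausdorff_measure.

(** * Integrals of affine functions along a segment *)

Section integral_on_segment.
Context {R : realType}.
Local Notation plane := 'cV[R]_2.
Local Notation H1 := (@hausdorff1 R).
Implicit Types (Y T u x y : plane) (A B L : R).
Local Open Scope ereal_scope.

Lemma continuous_affine A B : continuous (fun t : R => A + B * t)%R.
Proof.
move=> t; apply: cvgD; first exact: cvg_cst.
by apply: cvgM; [exact: cvg_cst|exact: cvg_id].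
Qed.

Lemma integral_affine A B L : (0 < L)%R ->
  \int[@lebesgue_measure R]_(x in `]0%R, L[) (A + B * x)%:E =
  (A * L + B * L ^+ 2 / 2)%:E.
Proof.
move=> L0; pose F (x : R) : R := (A * x + B / 2 * x ^+ 2)%R.
have dF (t : R) : is_derive t 1%R F (A + B * t)%R.
  by rewrite /F; apply: is_derive_eq; rewrite /GRing.scale/=; field.
have cF : continuous F.
  by move=> t; apply: differentiable_continuous; apply/derivable1_diffP; case: (dF t).
rewrite -(@integral_itv_bndoo _ _ _ _ true false); last first.
  apply/measurable_EFinP/measurable_funTS.
  by apply: continuous_measurable_fun; exact: continuous_affine.
rewrite (@continuous_FTC2 _ _ F)//.
- by rewrite /F -EFinB; congr EFin; field.
- by apply: continuous_subspaceT; exact: continuous_affine.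
- split; [by move=> x _; case: (dF x)|exact/cvg_at_right_filter/cF|].
  exact/cvg_at_left_filter/cF.
- by move=> x _; rewrite derive1E; apply: derive_val.
Qed.

Definition axis_segment Y u L : set plane := line Y u `&` abscissa Y u @^-1` `]0%R, L[.

Lemma measurable_axis_segment Y u L : enorm u = 1%R ->
  measurable (axis_segment Y u L : set (caratheodory_type (@hausdorff1_om R))).
Proof.
move=> u1; apply: measurableI; first exact: measurable_line.
rewrite -[X in measurable X]setTI; exact: measurable_abscissa.
Qed.

Lemma bounded_affine_abscissa Y u A B L :
  [bounded (A + B * abscissa Y u x)%R | x in abscissa Y u @^-1` `]0%R, L[].
Proof.
exists (`|A| + `|B| * L)%R; split; first exact: num_real.
move=> K MK x /=; rewrite in_itv/= => /andP[x0 xL].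
apply/(le_trans _ (ltW MK))/(le_trans (ler_normD _ _)); rewrite lerD2l normrM.
by rewrite ler_wpM2l// gtr0_norm// ltW.
Qed.

Lemma hausdorff1_axis_segment_fin Y u L : enorm u = 1%R -> (0 < L)%R ->
  H1 (axis_segment Y u L) < +oo.
Proof.
move=> u1 L0; apply: (@le_lt_trans _ _ (L - 0)%:E); last by rewrite ltry.
apply: le_trans (hausdorff1_segment_le Y u1 L0).
apply: (@le_outer_measure _ _ (@hausdorff1_om R)) => x [lx /=].
by rewrite !in_itv/= => /andP[x0 xL]; split; rewrite //= x0 ltW.
Qed.

Lemma measurable_affine_abscissa Y u A B D : enorm u = 1%R ->
  measurable_fun D ((fun x => A + B * abscissa Y u x)%R :
    caratheodory_type (@hausdorff1_om R) -> R).
Proof.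
move=> u1; apply: measurable_funTS.
have /measurableT_comp : measurable_fun setT (fun t => A + B * t)%R.
  by apply: continuous_measurable_fun; exact: continuous_affine.
by apply; exact: measurable_abscissa.
Qed.

Lemma integrable_axis_segment Y u A B L : enorm u = 1%R -> (0 < L)%R ->
  H1.-integrable (axis_segment Y u L) (fun x => (A + B * abscissa Y u x)%:E).
Proof.
move=> u1 L0; apply: measurable_bounded_integrable.
- exact: measurable_axis_segment.
- exact: hausdorff1_axis_segment_fin.
- exact: measurable_affine_abscissa.
- have [M [Mr HM]] := bounded_affine_abscissa Y u A B L.
  by exists M; split => // K MK x [_ xL]; exact: (HM K MK x xL).
Qed.

(* The abscissa pushes the restriction of the Hausdorff measure to the line
   forward to the Lebesgue measure. *)
Lemma integral_axis_segment Y u A B L : enorm u = 1%R -> (0 < L)%R ->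
  \int[H1]_(x in axis_segment Y u L) (A + B * abscissa Y u x)%:E =
  (A * L + B * L ^+ 2 / 2)%:E.
Proof.
move=> u1 L0; rewrite -integral_affine//.
have ml := measurable_line Y u1.
have ma : measurable_fun setT
    (abscissa Y u : caratheodory_type (@hausdorff1_om R) -> measurableTypeR R).
  exact: measurable_abscissa.
pose mu := mrestr H1 ml.
pose nu : measure (measurableTypeR R) R :=
  measure_function_pushforward__canonical__measure_function_Measure mu ma.
have lebE E : measurable E -> lebesgue_measure E = nu E.
  apply: lebesgue_measure_unique => _ [[a b] _ <-].
  rewrite /= lebesgue_measure_itv/= lte_fin /nu/= /pushforward /= /mrestr setIC.
  case: ifPn => ab.
    rewrite -EFinB; apply/eqP; rewrite eq_le hausdorff1_segment_ge//=.
    exact: hausdorff1_segment_le.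
  rewrite set_itv_ge ?bnd_simp// preimage_set0 setI0.
  exact/esym/(@outer_measure0 _ _ (@hausdorff1_om R)).
have mD : measurable (abscissa Y u @^-1` `]0%R, L[ : set (caratheodory_type (@hausdorff1_om R))).
  by rewrite -[X in measurable X]setTI; exact: measurable_abscissa.
have imu : mu.-integrable (abscissa Y u @^-1` `]0%R, L[)
    (fun x => (A + B * abscissa Y u x)%:E).
  apply: measurable_bounded_integrable.
  - exact: mD.
  - by rewrite /mu /= /mrestr setIC; exact: hausdorff1_axis_segment_fin.
  - exact: measurable_affine_abscissa.
  - exact: bounded_affine_abscissa.
rewrite [RHS](@eq_measure_integral _ _ _ _ nu); last first.
  by move=> E mE _; exact: lebE.
have mf : measurable_fun setT (fun t : R => (A + B * t)%:E).
  apply/measurable_EFinP; apply: continuous_measurable_fun.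
  exact: continuous_affine.
have mI : measurable (`]0%R, L[%classic : set R) by exact: measurable_itv.
rewrite (integral_pushforward ma mf imu mI).
have mCl : measurable (~` line Y u : set (caratheodory_type (@hausdorff1_om R))).
  exact: measurableC.
(* [mu] charges only the line, so the complement of the line can be removed from the domain; on what
   remains [mu] and the Hausdorff measure agree. *)
have mu0 : mu (~` line Y u) = 0.
  rewrite /mu /= /mrestr setICl; exact: (@outer_measure0 _ _ (@hausdorff1_om R)).
rewrite (negligible_integral mCl mD imu mu0).
rewrite setDE setCK setIC; apply: eq_measure_integral => E mE ES.
by rewrite /mu /= /mrestr setIidl// => x /ES[].
Qed.

Definition open_segment (Y T : plane) : set plane :=
  [set Y + s *: T | s in `]0, 1[]%R.

(** The value at the midpoint times the length. [G] lives on the whole plane so that functions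
    carried by different segments can be added before integrating. *)
Lemma integral_open_segment Y T A B (G : plane -> R) : T != 0%R ->
  (forall s, (0 < s < 1)%R -> G (Y + s *: T)%R = (A + B * s)%R) ->
  (forall x, ~ open_segment Y T x -> G x = 0%R) ->
  H1.-integrable setT (fun x => (G x)%:E) /\
  \int[H1]_x (G x)%:E = ((A + B / 2) * enorm T)%:E.
Proof.
move=> T0 GT G0; set L := enorm T; have L0 : (0 < L)%R by exact: enorm_gt0.
pose u := (L^-1 *: T)%R.
have u1 : enorm u = 1%R by rewrite enormZ gtr0_norm ?invr_gt0// mulVf// gt_eqF.
have TE s : (Y + s *: T = Y + (s * L) *: u)%R.
  by rewrite scalerA mulfK// gt_eqF.
(* The abscissa of the point of parameter [s] is [s * L], whence the slope [B / L]. *)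
have GE : (fun x => (G x)%:E) =
    (fun x => (A + B / L * abscissa Y u x)%:E) \_ (axis_segment Y u L).
  apply/funext => x; rewrite patchE; case: ifPn => [|/negP xS].
    rewrite inE => -[lx /=]; rewrite in_itv/= => /andP[x0 xL].
    rewrite [in LHS]lx -[abscissa Y u x](@divfK _ L) ?gt_eqF// -TE GT.
      by rewrite mulrAC mulrA divfK ?gt_eqF// mulrAC.
    by rewrite divr_gt0// ltr_pdivrMr// mul1r.
  rewrite G0// => -[s /=]; rewrite in_itv/= => /andP[s0 s1] xE; apply: xS.
  rewrite inE; split; rewrite /line/= -xE TE abscissaE//.
  by rewrite in_itv/= mulr_gt0//= gtr_pMl.
split.
  rewrite GE; apply/(integrable_mkcond _ (measurable_axis_segment Y L u1)).
  exact: integrable_axis_segment.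
rewrite GE -integral_mkcond integral_axis_segment//; congr EFin.
by field; rewrite gt_eqF.
Qed.

End integral_on_segment.

(** * Interface of an affine function in a triangle *)

Section interface.
Context {R : realType}.
Local Notation plane := 'cV[R]_2.
Implicit Types (x y a n q e : plane) (O U D : set plane) (phi : plane -> R).

Lemma continuous_dotv a : continuous (dotv a).
Proof.
have cM (i : 'I_2) : continuous (fun y : plane => a i 0 * y i 0).
  move=> y; apply: (@cvgM _ _ (nbhs y) _ (cst (a i 0)) (fun y : plane => y i 0)
    (a i 0) (y i 0)).
    exact: cvg_cst.
  exact: (@coord_continuous R 2 1 i 0 y).
rewrite (_ : dotv a = fun y => a 0 0 * y 0 0 + a 1 0 * y 1 0).
  by move=> y; exact: (cvgD (cM 0 y) (cM 1 y)).
by apply/funext => y; exact: dotvE.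
Qed.

Lemma continuous_ray x y : continuous (fun t : R => x + t *: y).
Proof.
move=> t; apply: cvgD; first exact: cvg_cst.
exact: scalel_continuous.
Qed.

Lemma nbhs_ray x y (P : set plane) : nbhs x P ->
  exists2 t : R, 0 < t & P (x + t *: y).
Proof.
move=> Px; have : x + t *: y @[t --> (0 : R)^'+] --> x.
  rewrite -[X in _ --> X]addr0 -(scale0r y).
  exact/cvg_at_right_filter/continuous_ray.
move=> /(_ _ Px) /= Pt.
have [t [t0 Pxt]] : exists t : R, 0 < t /\ P (x + t *: y).
  by apply: (@filter_ex _ (0 : R)^'+); apply: filterI => //; exact: nbhs_right_gt.
by exists t.
Qed.

(** Two distinct unit normals disagree along [v = n' - n]: with [c = 1 - dotv n n' > 0], the
    products of [v] with [n] and [n'] are [- c] and [c]. A short step along [v] would be inside [O]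
    for [n] and outside for [n']. The aperture [c / 2 / enorm v] makes the tolerance half of [c] per
    unit step. *)
Lemma is_outward_normal_inj O x n n' :
  is_outward_normal O x n -> is_outward_normal O x n' -> n' = n.
Proof.
move=> [n1 On] [n'1 On']; apply/eqP/negP => /negP nn'.
have nn0 : n' - n != 0 by rewrite subr_eq0.
pose v := n' - n; pose c := 1 - dotv n n'.
have nn : dotv n n = 1 by rewrite -enorm_sqr n1 expr1n.
have n'n' : dotv n' n' = 1 by rewrite -enorm_sqr n'1 expr1n.
have c0 : 0 < c.
  have := dotvv_gt0 nn0; rewrite dotvBl !dotvBr nn n'n' (dotvC n' n) /c; lra.
have v0 : 0 < enorm v by exact: enorm_gt0.
have eta0 : 0 < c / 2 / enorm v by rewrite !divr_gt0.
have [t t0] := nbhs_ray v (filterI (On _ eta0) (On' _ eta0)).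
rewrite /setI/= addrAC subrr add0r enormZ gtr0_norm// mulNr.
have -> : c / 2 / enorm v * (t * enorm v) = t * (c / 2).
  by field; rewrite gt_eqF.
rewrite !dotvZl [dotv v n]dotvBl [dotv v n']dotvBl nn n'n' (dotvC n' n).
rewrite -[1 - _]/c -[dotv n n' - 1]opprB -/c.
have tc : 0 < t * c by rewrite mulr_gt0.
move=> [[On1 _] [_ On2]]; apply: On2; [|apply: On1]; rewrite mulrA ?mulrN; lra.
Qed.

Lemma outward_normalE O x n : is_outward_normal O x n -> outward_normal O x = n.
Proof.
by move=> On; apply: xget_unique => // n'; exact: is_outward_normal_inj On.
Qed.

Lemma is_outward_normal_halfplane O x a : a != 0 ->
  (\forall y \near x, O y <-> dotv (y - x) a < 0) ->
  is_outward_normal O x ((enorm a)^-1 *: a).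
Proof.
move=> a0 Oa; have na0 := enorm_gt0 a0; split.
  by rewrite enormZ gtr0_norm ?invr_gt0// mulVf// gt_eqF.
move=> eta eta0; apply: filterS Oa => y [Oy1 Oy2].
have e0 : 0 <= eta * enorm (y - x) by rewrite mulr_ge0 ?enorm_ge0// ltW.
rewrite dotvZr; split => [h|h /Oy1].
  apply: Oy2; rewrite -(pmulr_rlt0 _ (x := (enorm a)^-1)) ?invr_gt0//.
  by apply: (lt_le_trans h); rewrite mulNr oppr_le0.
rewrite -(pmulr_rlt0 _ (x := (enorm a)^-1)) ?invr_gt0//.
by move=> /(lt_trans h); rewrite ltNge e0.
Qed.

Section affine.
Variables (D U : set plane) (phi : plane -> R) (a : plane) (b : R).
Hypotheses (openU : open U) (UD : U `<=` D) (a0 : a != 0).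
Hypothesis phiU : forall x, U x -> phi x = dotv a x + b.

Lemma affine_boundary x : U x -> boundary (Omega D phi) x <-> dotv a x + b = 0.
Proof.
move=> Ux; have nU : nbhs x U by exact: open_nbhs_nbhs.
have cphi : continuous (fun y => dotv a y + b).
  by move=> y; exact: (cvgD (@continuous_dotv a y) (cvg_cst b)).

split => [[clO nintO]|x0].
  apply/eqP; case: ltgtP => // ax; exfalso.
    apply: nintO; rewrite /interior/=.
    have : \forall y \near x, dotv a y + b < 0 by
      exact: (cphi x [set z | z < 0] (lt_nbhsl ax)).
    apply: filterS2 nU => y Uy yb; split; first exact: UD.
    by rewrite phiU.
  have : \forall y \near x, 0 < dotv a y + b by
      exact: (cphi x [set z | 0 < z] (lt_nbhsr ax)).
  move=> /(filterI nU)/clO[y [[Dy]]] /= + [Uy].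
  by rewrite phiU// => /ltW; rewrite leNgt => /negP.
split; last first.
  by move=> /interior_subset[_]; rewrite phiU// x0 ltxx.
(* A small step against the gradient enters the sublevel set. *)
move=> B Bx; have [t t0 [Ut Bt]] := nbhs_ray (- a) (filterI nU Bx).
exists (x + t *: - a); split => //; split; first exact: UD.
rewrite phiU// dotvDr dotvZr -scaleN1r dotvZr addrAC x0 add0r mulN1r mulrN.
by rewrite oppr_lt0 mulr_gt0// dotvv_gt0.
Qed.

Lemma affine_outward_normal x : U x -> dotv a x + b = 0 ->
  outward_normal (Omega D phi) x = (enorm a)^-1 *: a.
Proof.
move=> Ux x0; apply/outward_normalE/is_outward_normal_halfplane => //.
have nU : nbhs x U by exact: open_nbhs_nbhs.
apply: filterS nU => y Uy; rewrite /Omega/= phiU//.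
have -> : dotv a y + b = dotv (y - x) a by rewrite dotvBl !(dotvC _ a); lra.
by split => [[]//|]; split => //; exact: UD.
Qed.

End affine.
End interface.

(** * Triangles and determinants *)

Section triangle.
Context {R : realType}.
Local Notation plane := 'cV[R]_2.
Implicit Types (x y a q e w : plane) (p : 'I_3 -> plane) (D : set plane).
Implicit Types (phi : plane -> R) (V : plane -> plane).

(** The determinant of the columns [x] and [y]. *)
Definition cross x y : R := dotv (perp x) y.

Lemma det_mx2 (A : 'M[R]_2) : \det A = A 0 0 * A 1 1 - A 0 1 * A 1 0.
Proof.
rewrite (expand_det_row _ 0) !big_ord_recl big_ord0 addr0 /cofactor !det_mx11 !mxE.
have -> : lift ord0 ord0 = 1 :> 'I_2 by exact/val_inj.
have -> : lift 1 (0 : 'I_1) = 0 :> 'I_2 by exact/val_inj.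
by rewrite /= expr0 expr1 mul1r mulN1r mulrN.
Qed.

Lemma det_edge_mx q0 q1 q2 : \det (edge_mx q0 q1 q2) = cross (q1 - q0) (q2 - q0).
Proof.
have E0 i : edge_mx q0 q1 q2 i 0 = (q1 - q0) i 0.
  have -> : (0 : 'I_2) = @lshift 1 1 0 by exact/val_inj.
  exact: (row_mxEl (q1 - q0) (q2 - q0) i 0).
have E1 i : edge_mx q0 q1 q2 i 1 = (q2 - q0) i 0.
  have -> : (1 : 'I_2) = @rshift 1 1 0 by exact/val_inj.
  exact: (row_mxEr (q1 - q0) (q2 - q0) i 0).
by rewrite det_mx2 !E0 !E1 /cross dotvE !mxE/=; ring.
Qed.

Definition tri q0 q1 q2 : set plane :=
  [set x | exists c1 c2 : R, [/\ 0 < c1, 0 < c2, c1 + c2 < 1 &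
    x = q0 + c1 *: (q1 - q0) + c2 *: (q2 - q0)]].

Lemma sum_ord3 (V : nmodType) (F : 'I_3 -> V) : \sum_i F i = F 0 + F 1 + F 2.
Proof.
rewrite !big_ord_recl big_ord0 addr0 addrA.
by congr (F _ + F _ + F _); exact/val_inj.
Qed.

(** Any vertex may serve as the origin of the coordinates [c1], [c2]; this is what allows the vertex
    of isolated sign to come first. *)
Lemma open_triangle_perm p (s : 'I_3 -> 'I_3) : injective s ->
  open_triangle p = tri (p (s 0)) (p (s 1)) (p (s 2)).
Proof.
move=> sI; apply/seteqP; split => x.
  move=> [w [w0 w1 ->]]; exists (w (s 1)), (w (s 2)).
  have w1' : w (s 0) + w (s 1) + w (s 2) = 1.
    by rewrite -w1 (reindex_inj sI) sum_ord3.
  split => //; first by have := w0 (s 0); lra.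
  rewrite (reindex_inj sI) sum_ord3 (_ : w (s 0) = 1 - w (s 1) - w (s 2)); last lra.
  by apply: colP2; rewrite !mxE; ring.
move=> [c1 [c2 [c10 c20 c12 ->]]].
pose w i := if i == s 1 then c1 else if i == s 2 then c2 else 1 - c1 - c2.
have [w0E w1E w2E] : [/\ w (s 0) = 1 - c1 - c2, w (s 1) = c1 & w (s 2) = c2].
  by rewrite /w !(inj_eq sI) !eqxx.
exists w; split.
- by move=> i; rewrite /w; case: ifP => // _; case: ifP => // _; lra.
- by rewrite (reindex_inj sI) sum_ord3 w0E w1E w2E; lra.
- rewrite (reindex_inj sI) sum_ord3 w0E w1E w2E.
  by apply: colP2; rewrite !mxE; ring.
Qed.

Section cross_neq0.
Variables q0 q1 q2 : plane.
Local Notation e1 := (q1 - q0).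
Local Notation e2 := (q2 - q0).
Hypothesis c0 : cross e1 e2 != 0.

Lemma cramer x : x = (cross x e2 / cross e1 e2) *: e1 + (cross e1 x / cross e1 e2) *: e2.
Proof.
move: c0; rewrite /cross !dotvE !mxE/= => c0'.
by apply: colP2; rewrite !mxE; field.
Qed.

Lemma triE x : tri q0 q1 q2 x <-> [/\ 0 < cross (x - q0) e2 / cross e1 e2,
  0 < cross e1 (x - q0) / cross e1 e2 &
  cross (x - q0) e2 / cross e1 e2 + cross e1 (x - q0) / cross e1 e2 < 1].
Proof.
split=> [[c1 [c2 [c10 c20 c12 ->]]]|[? ? ?]].
  have -> : q0 + c1 *: e1 + c2 *: e2 - q0 = c1 *: e1 + c2 *: e2.
    by apply: colP2; rewrite !mxE; ring.
  have -> : cross (c1 *: e1 + c2 *: e2) e2 = c1 * cross e1 e2.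
    by rewrite /cross !dotvE !mxE/=; ring.
  have -> : cross e1 (c1 *: e1 + c2 *: e2) = c2 * cross e1 e2.
    by rewrite /cross !dotvE !mxE/=; ring.
  by rewrite !mulfK.
exists (cross (x - q0) e2 / cross e1 e2), (cross e1 (x - q0) / cross e1 e2).
split => //.
by rewrite -addrA -cramer addrC subrK.
Qed.

Lemma open_tri : open (tri q0 q1 q2).
Proof.
pose f x := cross (x - q0) e2 / cross e1 e2.
pose g x := cross e1 (x - q0) / cross e1 e2.
have aff w d : continuous (fun x => dotv w x + d).
  by move=> x; exact: (cvgD (@continuous_dotv _ w x) (cvg_cst d)).
have cf : continuous f.
  rewrite (_ : f = fun x => dotv (- (cross e1 e2)^-1 *: perp e2) x +
    dotv ((cross e1 e2)^-1 *: perp e2) q0); first exact: aff.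
  by apply/funext => x; rewrite /f; set c := cross e1 e2; rewrite /cross !dotvE !mxE/=; ring.
have cg : continuous g.
  rewrite (_ : g = fun x => dotv ((cross e1 e2)^-1 *: perp e1) x +
    dotv (- (cross e1 e2)^-1 *: perp e1) q0); first exact: aff.
  by apply/funext => x; rewrite /g; set c := cross e1 e2; rewrite /cross !dotvE !mxE/=; ring.
rewrite (_ : tri _ _ _ = f @^-1` [set t | 0 < t] `&` g @^-1` [set t | 0 < t] `&`
    (fun x => f x + g x) @^-1` [set t | t < 1]); last first.
  by apply/seteqP; split => x; [move=> /triE[]|move=> [[? ?] ?]; apply/triE].
apply: openI; first apply: openI.
- by apply: open_comp => [x _|]; [exact: cf|exact: open_gt].
- by apply: open_comp => [x _|]; [exact: cg|exact: open_gt].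
- apply: open_comp => [x _|]; last exact: open_lt.
  exact: (cvgD (cf x) (cg x)).
Qed.

End cross_neq0.
End triangle.

(** [- u / (v - u)] is the position on an edge of the root of the linear interpolant of [u] and [v].
    It equals 1, the far vertex, when [v = 0]. Expanding the fraction by [- u] covers both signs of
    [u] at once. *)
Lemma root_coef_gt0_le1 (R : realFieldType) (u v : R) : u != 0 -> v * u <= 0 ->
  0 < - u / (v - u) <= 1.
Proof.
move=> u0 vu; have u2 : 0 < u * u by rewrite -expr2 lt_def sqr_ge0 sqrf_eq0 u0.
have vu0 : v - u != 0 by apply: contraTneq vu => /eqP; rewrite subr_eq0 => /eqP ->; rewrite -ltNge.
have -> : - u / (v - u) = u * u / (u * u - v * u).
  by field; rewrite vu0 -mulrBl mulf_neq0// subr_eq0 eq_sym -subr_eq0.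
by rewrite divr_gt0 ?ler_pdivrMr//=; lra.
Qed.

Lemma root_coef_lt1 (R : realFieldType) (u v : R) : u != 0 -> v * u < 0 ->
  - u / (v - u) < 1.
Proof.
move=> u0 vu; have /andP[_] := root_coef_gt0_le1 u0 (ltW vu).
rewrite le_eqVlt => /orP[/eqP uv|//]; exfalso; move: vu.
have vu0 : v - u != 0.
  by apply/negP => /eqP vu0; move: uv; rewrite vu0 invr0 mulr0 => /esym/eqP; rewrite oner_eq0.
have : - u = v - u by rewrite -[RHS]mul1r -uv divfK.
by move=> /eqP; rewrite eq_sym -subr_eq0 opprK subrK => /eqP ->; rewrite mul0r ltxx.
Qed.

Section interface_in_triangle.
Context {R : realType}.
Local Notation plane := 'cV[R]_2.
Variables (q0 q1 q2 : plane) (D : set plane) (phi : plane -> R).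
Variables (a : plane) (b : R).
Local Notation e1 := (q1 - q0).
Local Notation e2 := (q2 - q0).
Hypothesis c0 : cross e1 e2 != 0.
Hypothesis triD : tri q0 q1 q2 `<=` D.
Hypothesis phi_tri : forall x, tri q0 q1 q2 x -> phi x = dotv a x + b.

(** The affine formula is known only in the open triangle; it reaches the vertex by continuity
    within [closure D], along the ray [g], which stays in the triangle for [0 < t < 1 / 2]. *)
Lemma tri_affine_vertex : {within closure D, continuous phi} ->
  phi q0 = dotv a q0 + b.
Proof.
move=> /subspace_continuousP cphi.
pose g t : plane := q0 + t *: (e1 + e2).
have gtri : \forall t \near 0^'+, tri q0 q1 q2 (g t).
  have t2 : \forall t \near (0 : R)^'+, t < 2^-1.
    by apply: nbhs_right_lt; rewrite invr_gt0.
  near=> t; exists t, t.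
  have t0 : 0 < t by near: t; exact: nbhs_right_gt.
  have t12 : t < 2^-1 by near: t.
  split => //; first lra.
  by apply: colP2; rewrite !mxE; ring.
have g0 : g t @[t --> (0 : R)^'+] --> q0.
  rewrite -[X in _ --> X]addr0 -(scale0r (e1 + e2)).
  exact/cvg_at_right_filter/continuous_ray.
have clq0 : closure D q0.
  move=> B Bq0; have : \forall t \near (0 : R)^'+, B (g t) by exact: g0.
  move=> Bg; have [t [gt Bt]] : exists t : R, tri q0 q1 q2 (g t) /\ B (g t).
    by apply: (@filter_ex _ (0 : R)^'+); exact: filterI.
  by exists (g t); split => //; exact: triD.
have phig : phi (g t) @[t --> (0 : R)^'+] --> phi q0.
  move=> P /(cphi _ clq0) /g0 /= Pg.
  suff : \forall t \near (0 : R)^'+, P (phi (g t)) by [].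
  near=> t; have : closure D (g t) -> P (phi (g t)) by near: t; exact: Pg.
  by apply; apply: subset_closure; apply: triD; near: t.
have phia : phi (g t) @[t --> (0 : R)^'+] --> dotv a q0 + b.
  have : dotv a (g t) + b @[t --> (0 : R)^'+] --> dotv a q0 + b.
    apply: cvgD; last exact: cvg_cst.
    exact: (cvg_comp _ _ g0 (@continuous_dotv _ a q0)).
  apply: cvg_trans; apply: near_eq_cvg; near=> t; apply/esym/phi_tri.
  by near: t.
exact: (cvg_unique _ phig phia).
Unshelve. all: by end_near. Qed.

Local Notation v0 := (dotv a q0 + b).
Local Notation v1 := (dotv a q1 + b).
Local Notation v2 := (dotv a q2 + b).
Local Notation Y1 := (root_pt q0 q1 v0 v1).
Local Notation Y2 := (root_pt q0 q2 v0 v2).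
Local Notation interface := (tri q0 q1 q2 `&` boundary (Omega D phi)).

(** After multiplication by [v1] no vertex value is negative and two are positive, so the affine
    function has no zero inside. This serves the cells of pattern A_+ whose node value [v0] is
    zero. *)
Lemma interface_set0 : v0 != v1 -> 0 <= v0 * v1 -> 0 < v2 * v1 -> interface = set0.
Proof.
move=> v01 v0v1 v2v1; apply: contrapT => /eqP/set0P[x [tx]].
have a0 : a != 0 by apply: contraNneq v01 => ->; rewrite !dot0v.
move=> /(affine_boundary (open_tri c0) triD a0 phi_tri tx).
case: tx => c1 [c2 [c10 c20 c12 ->]] x0.
have : (1 - c1 - c2) * (v0 * v1) + c1 * (v1 * v1) + c2 * (v2 * v1) = 0.
  rewrite -[RHS](mul0r v1) -x0 !dotvDr !dotvZr !dotvBr; ring.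
have : 0 < c2 * (v2 * v1) by rewrite mulr_gt0.
have : 0 <= c1 * (v1 * v1) by rewrite mulr_ge0 ?(ltW c10)// -expr2 sqr_ge0.
have : 0 <= (1 - c1 - c2) * (v0 * v1) by rewrite mulr_ge0//; lra.
lra.
Qed.

Hypotheses (v00 : v0 != 0) (v10 : v1 * v0 <= 0) (v20 : v2 * v0 < 0).

Let v0_gt0 : 0 < v0 ^+ 2.
Proof. by rewrite lt_def sqr_ge0 sqrf_eq0 v00. Qed.

Let v01 : v1 - v0 != 0.
Proof. by apply/negP => /eqP v01; move: v0_gt0 v10; rewrite expr2; nra. Qed.

Let v02 : v2 - v0 != 0.
Proof. by apply/negP => /eqP v02; move: v0_gt0 v20; rewrite expr2; nra. Qed.

Let a0 : a != 0.
Proof.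
apply: contraNneq v01 => ->; rewrite !dot0v !add0r subrr.
by [].
Qed.

(** In the coordinates [c1], [c2] the zero line is [c1 / al + c2 / be = 1], with [al] and [be] the
    positions of the roots on the two edges. Vertex 1 will be the perturbed node in the patterns B
    and C, where its value may vanish; hence [al <= 1] only, and [be < 1] keeps the open segment
    inside the triangle. *)
Lemma interface_segment : interface = open_segment Y1 (Y2 - Y1).
Proof.
have bd := affine_boundary (open_tri c0) triD a0 phi_tri.
have v1E : v1 - v0 = dotv a e1 by rewrite dotvBr; ring.
have v2E : v2 - v0 = dotv a e2 by rewrite dotvBr; ring.
have Yseg s : Y1 + s *: (Y2 - Y1) = q0 + ((1 - s) * (- v0 / (v1 - v0))) *: e1 +
    (s * (- v0 / (v2 - v0))) *: e2.
  by rewrite /root_pt; apply: colP2; rewrite !mxE; ring.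
set al := - v0 / (v1 - v0) in Yseg; set be := - v0 / (v2 - v0) in Yseg.
have alE : al * (v1 - v0) = - v0 by rewrite divfK.
have beE : be * (v2 - v0) = - v0 by rewrite divfK.
have [al0 al1] : 0 < al /\ al <= 1.
  by apply/andP; exact: root_coef_gt0_le1.
have [be0 be1] : 0 < be /\ be < 1.
  split; last exact: root_coef_lt1.
  by have /andP[] := root_coef_gt0_le1 v00 (ltW v20).
have phiE c1 c2 : dotv a (q0 + c1 *: e1 + c2 *: e2) + b =
    v0 + c1 * (v1 - v0) + c2 * (v2 - v0).
  by rewrite !dotvDr !dotvZr v1E v2E; ring.
apply/seteqP; split => x.
  move=> [tx /bd]; case: (tx) => c1 [c2 [c10 c20 c12 xE]] /(_ tx) x0.
  have : v0 * (1 - c1 / al - c2 / be) = 0.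
    have v0al : v0 / al = - (v1 - v0) by rewrite /al; field; apply/andP.
    have v0be : v0 / be = - (v2 - v0) by rewrite /be; field; apply/andP.
    move: x0; rewrite xE phiE => x0; rewrite -[RHS]x0.
    have -> : v0 * (1 - c1 / al - c2 / be) = v0 - c1 * (v0 / al) - c2 * (v0 / be).
      by ring.
    by rewrite v0al v0be; ring.
  move=> /eqP; rewrite mulf_eq0 (negbTE v00)/= => /eqP c12E.
  exists (c2 / be).
    rewrite /= in_itv/= divr_gt0//=.
    have : 0 < c1 / al by rewrite divr_gt0.
    by lra.
  by rewrite Yseg xE divfK ?gt_eqF// (_ : 1 - c2 / be = c1 / al) ?divfK ?gt_eqF//; lra.
move=> [s /=]; rewrite in_itv/= => /andP[s0 s1] <-.
have tx : tri q0 q1 q2 (Y1 + s *: (Y2 - Y1)).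
  rewrite Yseg; do 2 eexists; split; last by [].
  - by rewrite mulr_gt0// subr_gt0.
  - by rewrite mulr_gt0.
  - have : 0 <= (1 - s) * (1 - al) by rewrite mulr_ge0// subr_ge0// ltW.
    have : 0 < s * (1 - be) by rewrite mulr_gt0// subr_gt0.
    by lra.
split => //; apply/bd => //; rewrite Yseg phiE.
have -> : v0 + (1 - s) * al * (v1 - v0) + s * be * (v2 - v0) =
    v0 + (1 - s) * (al * (v1 - v0)) + s * (be * (v2 - v0)) by ring.
by rewrite alE beE; ring.
Qed.

(** [(v2 - v0) *: e1 - (v1 - v0) *: e2] is orthogonal to [a]. The segment is an explicit multiple of
    it, and its quarter turn is [cross e1 e2 *: a], so the length is a multiple of [enorm a]. *)
Lemma interface_length :
  enorm (Y2 - Y1) = `|v0 * cross e1 e2 / ((v1 - v0) * (v2 - v0))| * enorm a.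
Proof.
have d1E : v1 - v0 = dotv a e1 by rewrite dotvBr; ring.
have d2E : v2 - v0 = dotv a e2 by rewrite dotvBr; ring.
have TE : Y2 - Y1 = (v0 / ((v1 - v0) * (v2 - v0))) *:
    ((v2 - v0) *: e1 - (v1 - v0) *: e2).
  move: v01 v02; rewrite /root_pt; move: (v1 - v0) (v2 - v0) => d1 d2 d10 d20.
  by apply: colP2; rewrite !mxE; field; apply/andP.
have aE : cross e1 e2 *: a = perp (dotv a e2 *: e1 - dotv a e1 *: e2).
  by rewrite /cross !dotvE; apply: colP2; rewrite !mxE/=; ring.
rewrite -enormZ mulrAC -scalerA aE -d1E -d2E TE -[LHS]enorm_perp; congr enorm.
by apply: colP2; rewrite !mxE/=; ring.
Qed.

Lemma root_pt_neq : Y2 - Y1 != 0.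
Proof.
apply/eqP => T0; have := interface_length; rewrite T0 /enorm dot0v sqrtr0.
move=> /esym/eqP; rewrite mulf_eq0 normr_eq0 => /orP[|].
  by rewrite mulf_eq0 invr_eq0 !mulf_eq0 !(negbTE v00, negbTE c0, negbTE v01, negbTE v02).
by apply/negP; rewrite gt_eqF// enorm_gt0.
Qed.

Lemma integral_interface (V : plane -> plane) (w1 w2 : plane) (c : R) :
  (forall s, 0 < s < 1 -> V (Y1 + s *: (Y2 - Y1)) = (1 - s) *: w1 + s *: w2) ->
  let G := (fun x => c * dotv (V x) (outward_normal (Omega D phi) x)) \_ interface in
  (@hausdorff1 R).-integrable setT (fun x => (G x)%:E) /\
  (\int[@hausdorff1 R]_x (G x)%:E)%E = (c * ((dotv w1 a + dotv w2 a) / 2 *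
    `|v0 * cross e1 e2 / ((v1 - v0) * (v2 - v0))|))%:E.
Proof.
move=> VE G.
pose A := c * dotv w1 a / enorm a; pose B := c * (dotv w2 a - dotv w1 a) / enorm a.
have GS s : 0 < s < 1 -> G (Y1 + s *: (Y2 - Y1)) = A + B * s.
  move=> s01; have : open_segment Y1 (Y2 - Y1) (Y1 + s *: (Y2 - Y1)) by exists s.
  rewrite -interface_segment => xI; rewrite /G patchE mem_set//.
  rewrite (affine_outward_normal (open_tri c0) triD a0 phi_tri); last 2 first.
  - by case: xI.
  - by apply/(affine_boundary (open_tri c0) triD a0 phi_tri); case: xI.
  rewrite VE// dotvZr dotvDl !dotvZl /A /B; field.
  by rewrite gt_eqF ?enorm_gt0.
have G0 x : ~ open_segment Y1 (Y2 - Y1) x -> G x = 0.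
  by rewrite -interface_segment /G patchE => xI; rewrite memNset.
have [? ->] := integral_open_segment root_pt_neq GS G0; split => //; congr EFin.
rewrite interface_length /A /B; field.
by rewrite gt_eqF ?enorm_gt0.
Qed.

End interface_in_triangle.

(** * Velocity of the parametrized interface *)

Section param_derivative.
Context {R : realType}.
Implicit Types (p q e : 'cV[R]_2) (f g : R -> R).

Lemma derive1_affine_comb p e e' f g (df dg : R) :
  is_derive (0 : R) 1 f df -> is_derive (0 : R) 1 g dg ->
  derive1 (fun t : R => p + f t *: e + g t *: e') 0 = df *: e + dg *: e'.
Proof.
move=> [fd fE] [gd gE]; rewrite /derive1; apply/cvg_lim => //.
have cf : h^-1 * (f (h + 0) - f 0) @[h --> 0^'] --> df.
  rewrite -fE; have := fd; rewrite /derivable /derive.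
  by under eq_fun do rewrite /GRing.scale/= mulr1.
have cg : h^-1 * (g (h + 0) - g 0) @[h --> 0^'] --> dg.
  rewrite -gE; have := gd; rewrite /derivable /derive.
  by under eq_fun do rewrite /GRing.scale/= mulr1.
rewrite [X in X @ _](_ : _ = fun h : R => (h^-1 * (f (h + 0) - f 0)) *: e +
    (h^-1 * (g (h + 0) - g 0)) *: e'); last first.
  by apply/funext => h; apply: colP2; rewrite !mxE; ring.
have cfe : h^-1 * (f (h + 0) - f 0) *: e @[h --> 0^'] --> df *: e by exact: cvgZr_tmp.
have cge : h^-1 * (g (h + 0) - g 0) *: e' @[h --> 0^'] --> dg *: e' by exact: cvgZr_tmp.
exact: (cvgD cfe cge).
Qed.

Lemma is_derive_root_coef (u v m n : R) : v != u ->
  is_derive (0 : R) 1 (fun t : R => - ((u + m * t) / (v + n * t - (u + m * t))))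
    (- ((m * v - u * n) / (v - u) ^+ 2)).
Proof.
move=> vu; have vu0 : v + n * 0 - (u + m * 0) != 0.
  by rewrite !mulr0 !addr0 subr_eq0.
have dN : is_derive (0 : R) 1 (fun t : R => u + m * t) m.
  by apply: is_derive_eq; rewrite /GRing.scale/=; ring.
have dD : is_derive (0 : R) 1 (fun t : R => v + n * t - (u + m * t)) (n - m).
  by apply: is_derive_eq; rewrite /GRing.scale/=; ring.
have dV := @is_deriveV R (fun t => v + n * t - (u + m * t)) 0 (n - m) 1 vu0 dD.
have dM := is_deriveN (is_deriveM dN dV).
apply: (@is_derive_eq _ _ _ _ _ _ _ _ dM).
rewrite /GRing.scale/= !mulr0 !addr0; field.
by rewrite subr_eq0.
Qed.

(* [pA], [pB] and [pC] with the vertices reordered so that the one of isolated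
   sign comes first; [m] is 1 at the perturbed node and 0 at the others. *)
Definition param_root q0 q1 q2 (v0 v1 v2 m0 m1 m2 t s : R) : 'cV[R]_2 :=
  (1 - s) *: root_pt q0 q1 (v0 + m0 * t) (v1 + m1 * t) +
  s *: root_pt q0 q2 (v0 + m0 * t) (v2 + m2 * t).

Lemma derive1_param_root q0 q1 q2 (v0 v1 v2 m0 m1 m2 s : R) :
  v1 != v0 -> v2 != v0 ->
  derive1 (param_root q0 q1 q2 v0 v1 v2 m0 m1 m2 ^~ s) 0 =
  (1 - s) *: (- ((m0 * v1 - v0 * m1) / (v1 - v0) ^+ 2) *: (q1 - q0)) +
  s *: (- ((m0 * v2 - v0 * m2) / (v2 - v0) ^+ 2) *: (q2 - q0)).
Proof.
move=> v10 v20.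
rewrite [X in derive1 X](_ : _ = fun t : R => q0 +
  - ((v0 + m0 * t) / (v1 + m1 * t - (v0 + m0 * t))) *: ((1 - s) *: (q1 - q0)) +
  - ((v0 + m0 * t) / (v2 + m2 * t - (v0 + m0 * t))) *: (s *: (q2 - q0))); last first.
  by apply/funext => t; rewrite /param_root/root_pt; apply: colP2; rewrite !mxE; ring.
rewrite (derive1_affine_comb _ _ _ (is_derive_root_coef _ _ v10) (is_derive_root_coef _ _ v20)).
by congr (_ + _); rewrite !scalerA mulrC.
Qed.

End param_derivative.

(** * Cells of the mesh *)

Section cells.
Context {R : realType}.
Local Notation plane := 'cV[R]_2.
Variables (D : set plane) (M N : nat) (T : mesh D M N).
Variables (hat : 'I_M -> plane -> R) (phi : plane -> R) (k : 'I_M).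
Implicit Types (l : 'I_N) (i j : 'I_3).
Local Notation x_ := (lx T k).
Local Notation f_ := (lphi T phi k).

(** Cyclic relabelling keeps the orientation, which carries [vertex_ccw] over to the labelling that
    starts at [k]. *)
Lemma cross_rot (p : 'I_3 -> plane) i :
  cross (p (i + 1) - p i) (p (i + 2) - p i) = cross (p 1 - p 0) (p 2 - p 0).
Proof.
have [->|i0] := eqVneq i 0; first by rewrite !add0r.
have [->|i1] := eqVneq i 1.
  have -> : 1 + 1 = 2 :> 'I_3 by exact/val_inj.
  have -> : 1 + 2 = 0 :> 'I_3 by exact/val_inj.
  by rewrite /cross !dotvE !mxE/=; ring.
have -> : i = 2 by apply/val_inj; case: i i0 i1 => -[|[|[|]]].
have -> : 2 + 1 = 0 :> 'I_3 by exact/val_inj.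
have -> : 2 + 2 = 1 :> 'I_3 by exact/val_inj.
by rewrite /cross !dotvE !mxE/=; ring.
Qed.

Lemma det_J_gt0 l : 0 < \det (J T k l).
Proof.
rewrite /J det_edge_mx /lx /lv; set r := odflt _ _.
rewrite addr0 (cross_rot (fun j => node T (vertex T l j))) -det_edge_mx.
exact: vertex_ccw.
Qed.

Lemma tau_tri l (s : 'I_3 -> 'I_3) : injective s ->
  tau T l = tri (x_ l (s 0)) (x_ l (s 1)) (x_ l (s 2)).
Proof.
move=> sI.
rewrite /tau (@open_triangle_perm _ _
  (fun i => odflt 0 [pick i | vertex T l i == k] + s i))//.
by move=> i j /addrI /sI.
Qed.

Lemma lphi_affine l : S1h T phi -> exists a b,
  (forall x, tau T l x -> phi x = dotv a x + b) /\
  forall i, f_ l i = dotv a (x_ l i) + b.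
Proof.
move=> [cphi /(_ l)[a [b phil]]]; exists a, b; split => // i.
(* Rotate the triangle so that vertex [i] becomes the base vertex of [tri_affine_vertex]. *)
have tE : tau T l = tri (x_ l i) (x_ l (i + 1)) (x_ l (i + 2)).
  by rewrite (@tau_tri l (+%R i)) ?addr0//; exact: addrI.
apply: (@tri_affine_vertex _ _ (x_ l (i + 1)) (x_ l (i + 2)) D) => //.
  by rewrite -tE; exact: mesh_sub.
by rewrite -tE.
Qed.

Lemma hat_lv l i : hat_basis T hat -> i != 0 -> hat k (x_ l i) = 0.
Proof.
move=> hatT i0; rewrite /lx (hatT k).2; apply/eqP; rewrite pnatr_eq0 eqb0.
apply/negP => /eqP kE.
(* A repeated vertex would make the positive determinant of [vertex_ccw] vanish. *)
have vI : injective (vertex T l).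
  move=> j j' vjj'; apply/eqP; apply: contraT => jj'.
  have := vertex_ccw T l.
  rewrite det_edge_mx -(cross_rot (fun i => node T (vertex T l i)) j).
  have [d d0 j'E] : exists2 d, d != 0 & j' = j + d.
    by exists (j' - j); [rewrite subr_eq0 eq_sym|rewrite addrC subrK].
  rewrite j'E in vjj'; have [d1|d1] := eqVneq d 1.
    by rewrite -d1 -vjj' subrr /cross !dotvE !mxE/= !(oppr0, mul0r, addr0) ltxx.
  have d2 : d = 2 by apply/val_inj; case: d d0 d1 {j'E vjj'} => -[|[|[|]]].
  by rewrite -d2 -vjj' subrr /cross !dotvE !mxE/= !mulr0 addr0 ltxx.
(* When [k] is not a vertex of the cell, [lv] starts at the default index 0, and no label can equal
   [k]. *)
rewrite /lv in kE; case: pickP kE => [r /= /eqP rk|nk] /= kE.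
  have /vI := etrans rk kE.
  by move/eqP; rewrite -[X in X == _]addr0 (inj_eq (addrI _)) eq_sym (negbTE i0).
by have := nk (0 + i); rewrite -kE eqxx.
Qed.

(* The sign of [f_ l 0] is only weak when [t 0 = 1]: the node value may vanish
   before the perturbation. *)
Lemma sign_cellsP l (t : 'I_3 -> R) : hat_basis T hat -> l \in sign_cells T hat phi k t ->
  [/\ Num.sg (f_ l 1) = t 1, Num.sg (f_ l 2) = t 2,
     t 0 = 1 -> 0 <= f_ l 0 & t 0 = -1 -> f_ l 0 < 0].
Proof.
move=> hatT; rewrite inE => /andP[_ /asboolP sg_t].
have hat0 : 0 <= hat k (x_ l 0) <= 1.
  by rewrite /lx (hatT k).2 ler0n /=; case: eqP; rewrite ?lexx ?ler01.
have [h0 h1] := andP hat0.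
(* A perturbation smaller than [d] cannot reverse a nonzero nodal value. *)
pose d := if f_ l 0 == 0 then 1 else `|f_ l 0|.
have d0 : 0 < d by rewrite /d; case: ifPn => // f0; rewrite normr_gt0.
have [e [[e0 ed] se]] : exists e : R, (0 < e /\ e < d) /\
    forall j, Num.sg (f_ l j + e * hat k (x_ l j)) = t j.
  apply: (@filter_ex _ (0 : R)^'+); apply: filterI => //.
  by apply: filterI; [exact: nbhs_right_gt|exact: nbhs_right_lt].
have e0h : 0 <= e * hat k (x_ l 0) by rewrite mulr_ge0// ltW.
have ehd : e * hat k (x_ l 0) < d by rewrite (le_lt_trans _ ed)// ler_piMr// ltW.
split.
- by rewrite -(se 1) hat_lv// mulr0 addr0.
- by rewrite -(se 2) hat_lv// mulr0 addr0.
- move=> t1; have := se 0; rewrite t1 => /eqP; rewrite sgr_cp0 leNgt => s0.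
  apply/negP => f0; move: ehd; rewrite /d lt_eqF// ltr0_norm//; lra.
- by move=> t1; have := se 0; rewrite t1 => /eqP; rewrite sgr_cp0; lra.
Qed.

Lemma tau_unique l l' x : tau T l x -> tau T l' x -> l = l'.
Proof.
move=> tx tx'; apply/eqP; apply: contraT => /(mesh_disjoint T).
by move=> /seteqP[/(_ x) h _]; exfalso; apply: h.
Qed.

Lemma Vk_eq0 x : (forall l, l \in cut_cells T hat phi k ->
  ~ (tau T l `&` boundary (Omega D phi)) x) -> Vk T hat phi k x = 0.
Proof. by move=> nx; apply: xgetPN => v [l [s [/nx]]]. Qed.

Section cell.
Variables (l : 'I_N) (s : 'I_3 -> 'I_3) (m0 m1 m2 : R).
Local Notation q i := (x_ l (s i)).
Local Notation v i := (f_ l (s i)).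
Hypotheses (phiT : S1h T phi) (lC : l \in cut_cells T hat phi k).
Hypotheses (sI : injective s).
Hypothesis paramE : param T hat phi k l =
  param_root (q 0) (q 1) (q 2) (v 0) (v 1) (v 2) m0 m1 m2.
Hypotheses (detE : `|cross (q 1 - q 0) (q 2 - q 0)| = `|\det (J T k l)|).
Hypotheses (v00 : v 0 != 0) (v10 : v 1 * v 0 <= 0) (v20 : v 2 * v 0 < 0).
Local Notation interface := (tau T l `&` boundary (Omega D phi)).

(** The velocity of each root is a multiple of its edge vector, whose product with the gradient is
    the difference of the nodal values; this removes one power from each squared denominator of
    [derive1_param_root]. *)
Lemma integral_cell (c : R) :
  let G := (fun x => c * dotv (Vk T hat phi k x)
    (outward_normal (Omega D phi) x)) \_ interface in
  (@hausdorff1 R).-integrable setT (fun x => (G x)%:E) /\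
  (\int[@hausdorff1 R]_x (G x)%:E)%E =
    (- (c * (((m0 * v 1 - v 0 * m1) / (v 1 - v 0) +
      (m0 * v 2 - v 0 * m2) / (v 2 - v 0)) / 2 *
    (`|v 0 / ((v 1 - v 0) * (v 2 - v 0))| * `|\det (J T k l)|))))%:E.
Proof.
have [a [b [phil vE]]] := lphi_affine l phiT.
have c0 : cross (q 1 - q 0) (q 2 - q 0) != 0.
  by rewrite -normr_gt0 detE normr_gt0 gt_eqF// det_J_gt0.
have tE := tau_tri l sI.
have triD : tri (q 0) (q 1) (q 2) `<=` D by rewrite -tE; exact: mesh_sub.
have phit x : tri (q 0) (q 1) (q 2) x -> phi x = dotv a x + b by rewrite -tE; exact: phil.
have v10' : v 1 != v 0.
  apply/eqP => v1E; move: v10; rewrite v1E -expr2 leNgt lt_def sqr_ge0 sqrf_eq0.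
  by rewrite v00.
have v20' : v 2 != v 0.
  by apply/eqP => v2E; move: v20; rewrite v2E -expr2 ltNge sqr_ge0.
pose w1 := - ((m0 * v 1 - v 0 * m1) / (v 1 - v 0) ^+ 2) *: (q 1 - q 0).
pose w2 := - ((m0 * v 2 - v 0 * m2) / (v 2 - v 0) ^+ 2) *: (q 2 - q 0).
have v00e := v00; have v10e := v10; have v20e := v20.
rewrite !vE in v00e v10e v20e.
pose Y1 := root_pt (q 0) (q 1) (v 0) (v 1); pose Y2 := root_pt (q 0) (q 2) (v 0) (v 2).
have T0 : Y2 - Y1 != 0.
  rewrite /Y1 /Y2 !vE; exact: (root_pt_neq c0 v00e v10e v20e).
have param0 t : param T hat phi k l 0 t = Y1 + t *: (Y2 - Y1).
  rewrite paramE /param_root !mulr0 !addr0 -/Y1 -/Y2.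
  by apply: colP2; rewrite !mxE; ring.
have interE : interface = open_segment Y1 (Y2 - Y1).
  by rewrite tE /Y1 /Y2 !vE; exact: (interface_segment c0 triD phit).
have VE t : 0 < t < 1 -> Vk T hat phi k (Y1 + t *: (Y2 - Y1)) = (1 - t) *: w1 + t *: w2.
  move=> t01; have xI : interface (Y1 + t *: (Y2 - Y1)) by rewrite interE; exists t.
  have dE t' : derive1 (param T hat phi k l ^~ t') 0 = (1 - t') *: w1 + t' *: w2.
    by rewrite paramE derive1_param_root.
  apply: xget_unique.
    exists l, t; split => //; rewrite ?param0//.
    by case/andP: t01 => /ltW -> /ltW ->.
  move=> w [l' [t' [_ xI' _ xE ->]]].
  have ll' : l' = l by apply: tau_unique xI'.1 xI.1.
  move: xE; rewrite ll' param0 dE => /addrI/eqP; rewrite -subr_eq0 -scalerBl scaler_eq0.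
  by rewrite (negbTE T0) orbF subr_eq0 => /eqP ->.
rewrite tE; have := integral_interface c0 triD phit v00e v10e v20e
  (V := Vk T hat phi k) (w1 := w1) (w2 := w2) c.
rewrite -!vE => /(_ VE)[iG intG]; split; first exact: iG.
apply: (etrans intG); congr EFin.
have qE i : dotv (q i - q 0) a = v i - v 0 by rewrite dotvBl !(dotvC _ a) !vE; ring.
rewrite /w1 /w2 !dotvZl !qE [v 0 * _ / _]mulrAC normrM detE; field.
by rewrite !subr_eq0 v10' v20'.
Qed.

End cell.
End cells.

(** * The six sign patterns and the sum over the cells *)

Definition perm3 (i0 i1 i2 : 'I_3) (i : 'I_3) : 'I_3 :=
  if i == 0 then i0 else if i == 1 then i1 else i2.

Lemma perm3E i0 i1 i2 :
  (perm3 i0 i1 i2 0 = i0) * (perm3 i0 i1 i2 1 = i1) * (perm3 i0 i1 i2 2 = i2).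
Proof. by []. Qed.

Lemma perm3_inj i0 i1 i2 : uniq [:: i0; i1; i2] -> injective (perm3 i0 i1 i2).
Proof.
rewrite /= !inE negb_or andbT => /andP[/andP[/eqP i01 /eqP i02] /eqP i12] i j.
have I3 (i' : 'I_3) : [\/ i' = 0, i' = 1 | i' = 2].
  by case: i' => -[|[|[|//]]] i'; [apply: Or31|apply: Or32|apply: Or33]; exact/val_inj.
by rewrite /perm3; case: (I3 i) => ->; case: (I3 j) => -> //= /esym // /esym.
Qed.

(** Both [v - u] and [w - u] have the sign opposite to that of [u], even if [v = 0], so the
    denominator is positive. The factor [Num.sg u] that remains is the leading sign of [d_k a_l]. *)
Lemma norm_root_weight (R : realFieldType) (u v w : R) :
  u != 0 -> v * u <= 0 -> w * u < 0 ->
  `|u / ((v - u) * (w - u))| = Num.sg u * (u / ((v - u) * (w - u))).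
Proof.
move=> u0 vu wu; have u2 : 0 < u ^+ 2 by rewrite lt_def sqr_ge0 sqrf_eq0 u0.
have P0 : 0 < (v - u) * (w - u).
  rewrite -(pmulr_rgt0 _ u2).
  have -> : u ^+ 2 * ((v - u) * (w - u)) = (u ^+ 2 - v * u) * (u ^+ 2 - w * u) by ring.
  by rewrite mulr_gt0//; lra.
by rewrite normrM (gtr0_norm (x := _^-1)) ?invr_gt0// normrEsg mulrA.
Qed.

(** Here and in [dBC_identity], [x] is the value at the perturbed node, [e] the sign of the isolated
    value and [n] the absolute determinant. The isolated value is [x] here and [y] there. *)
Lemma dA_identity (R : realFieldType) (e x y z n : R) : y != x -> z != x ->
  - (((1 * y - x * 0) / (y - x) + (1 * z - x * 0) / (z - x)) / 2 *
    (e * (x / ((y - x) * (z - x))) * n)) =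
  e * (n * (x * (x * (y + z) - 2 * y * z)) / (2 * (x - y) ^+ 2 * (x - z) ^+ 2)).
Proof. by move=> yx zx; field; rewrite !subr_eq0 !(eq_sym x) yx zx. Qed.

Lemma dBC_identity (R : realFieldType) (e x y z n : R) : y != x -> z != y ->
  ((0 * x - y * 1) / (x - y) + (0 * z - y * 0) / (z - y)) / 2 *
    (e * (y / ((x - y) * (z - y))) * n) =
  e * (n / 2 * (y ^+ 2 / ((y - z) * (y - x) ^+ 2))).
Proof.
move=> yx zy; have [xy yz] : x != y /\ y != z by split; rewrite eq_sym.
by field; rewrite !subr_eq0 ?yx ?zy ?xy ?yz.
Qed.

Section mesh_shape_derivative.
Context {R : realType}.
Local Notation plane := 'cV[R]_2.
Variables (D : set plane) (M N : nat) (T : mesh D M N).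
Variables (hat : 'I_M -> plane -> R) (phi : plane -> R) (k : 'I_M) (c : R).
Hypotheses (hatT : hat_basis T hat) (phiT : S1h T phi).
Hypothesis std : standing_assumption T hat phi k.
Local Notation f_ := (lphi T phi k).
Local Notation integrand := (fun x => c * dotv (Vk T hat phi k x)
    (outward_normal (Omega D phi) x)).
Local Notation interface l := (tau T l `&` boundary (Omega D phi)).

Lemma notin_disjoint (A B : {set 'I_N}) l : (A :&: B)%SET == finset.set0 ->
  l \in B -> (l \in A) = false.
Proof.
by move=> /eqP/setP/(_ l); rewrite finset.in_setI finset.in_set0 => + lB; rewrite lB andbT.
Qed.

Lemma integral_cell_dka l : l \in cut_cells T hat phi k ->
  let G := integrand \_ (interface l) in
  (@hausdorff1 R).-integrable setT (fun x => (G x)%:E) /\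
  (\int[@hausdorff1 R]_x (G x)%:E)%E = (c * dka T hat phi k l)%:E.
Proof.
move=> lC G.
have [cutE pw] := std; rewrite /= !andbT in pw.
(* Disjointness decides the nested conditionals of [param] and [dka]; a prime marks a pattern with
   superscript minus. *)
move: pw => /andP[/and5P[ab ac aa' ab' ac']].
move=> /andP[/and4P[bc ba' bb' bc']] /andP[/and3P[ca' cb' cc']].
move=> /andP[/andP[a'b' a'c'] b'c'].
move: (lC); rewrite cutE /IABC_seq !big_cons big_nil !finset.in_setU finset.in_set0 orbF.
have nd := notin_disjoint.
have paramA : l \in (IA T hat phi k 1 :|: IA T hat phi k (-1))%SET ->
    param T hat phi k l = param_root (lx T k l 0) (lx T k l 1) (lx T k l 2)
      (f_ l 0) (f_ l 1) (f_ l 2) 1 0 0.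
  move=> lA; apply/funext => e; apply/funext => t; rewrite /param lA /pA /param_root.
  by rewrite mul1r !mul0r !addr0.
have paramB : (l \in (IA T hat phi k 1 :|: IA T hat phi k (-1))%SET) = false ->
    l \in (IB T hat phi k 1 :|: IB T hat phi k (-1))%SET ->
    param T hat phi k l = param_root (lx T k l 1) (lx T k l 0) (lx T k l 2)
      (f_ l 1) (f_ l 0) (f_ l 2) 0 1 0.
  move=> lA lB; apply/funext => e; apply/funext => t.
  by rewrite /param lA lB /pB /param_root mul1r !mul0r !addr0.
have paramC : (l \in (IA T hat phi k 1 :|: IA T hat phi k (-1))%SET) = false ->
    (l \in (IB T hat phi k 1 :|: IB T hat phi k (-1))%SET) = false ->
    param T hat phi k l = param_root (lx T k l 2) (lx T k l 0) (lx T k l 1)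
      (f_ l 2) (f_ l 0) (f_ l 1) 0 1 0.
  move=> lA lB; apply/funext => e; apply/funext => t.
  by rewrite /param lA lB /pC /param_root mul1r !mul0r !addr0.
have cellA := @integral_cell _ _ _ _ T hat phi k l (perm3 0 1 2) 1 0 0 phiT lC
  (@perm3_inj 0 1 2 isT) (paramA _).
have cellB := @integral_cell _ _ _ _ T hat phi k l (perm3 1 0 2) 0 1 0 phiT lC
  (@perm3_inj 1 0 2 isT) (paramB _ _).
have cellC := @integral_cell _ _ _ _ T hat phi k l (perm3 2 0 1) 0 1 0 phiT lC
  (@perm3_inj 2 0 1 isT) (paramC _ _).
rewrite !perm3E in cellA cellB cellC.
have detE : \det (J T k l) = cross (lx T k l 1 - lx T k l 0) (lx T k l 2 - lx T k l 0).
  by rewrite /J det_edge_mx.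
have dB : `|cross (lx T k l 0 - lx T k l 1) (lx T k l 2 - lx T k l 1)| = `|\det (J T k l)|.
  by rewrite -normrN detE; congr `|_|; rewrite /cross !dotvE !mxE/=; ring.
have dC : `|cross (lx T k l 0 - lx T k l 2) (lx T k l 1 - lx T k l 2)| = `|\det (J T k l)|.
  by rewrite detE; congr `|_|; rewrite /cross !dotvE !mxE/=; ring.
have pos (t : R) : Num.sg t = 1 -> 0 < t by move=> /eqP; rewrite sgr_cp0.
have neg (t : R) : Num.sg t = -1 -> t < 0 by move=> /eqP; rewrite sgr_cp0.
have lA1 : l \in IA T hat phi k 1 ->
    l \in (IA T hat phi k 1 :|: IA T hat phi k (-1))%SET.
  by rewrite finset.in_setU => ->.
have lA2 : l \in IA T hat phi k (-1) ->
    l \in (IA T hat phi k 1 :|: IA T hat phi k (-1))%SET.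
  by rewrite finset.in_setU orbC => ->.
have lB1 : l \in IB T hat phi k 1 ->
    l \in (IB T hat phi k 1 :|: IB T hat phi k (-1))%SET.
  by rewrite finset.in_setU => ->.
have lB2 : l \in IB T hat phi k (-1) ->
    l \in (IB T hat phi k 1 :|: IB T hat phi k (-1))%SET.
  by rewrite finset.in_setU orbC => ->.
have nU (A B C : {set 'I_N}) : (A :&: C)%SET == finset.set0 ->
    (B :&: C)%SET == finset.set0 -> l \in C -> (l \in (A :|: B)%SET) = false.
  by move=> dA1 dB1 lX; rewrite finset.in_setU (nd _ _ _ dA1 lX) (nd _ _ _ dB1 lX).
rewrite finset.setIC in ba'; rewrite finset.setIC in ca'; rewrite finset.setIC in cb'.
move=> /or4P[lA|lB|lC'|/or3P[lA'|lB'|lC'']].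
- have sP := sign_cellsP hatT lA; rewrite /= in sP.
  case: sP => [/neg f1 /neg f2 /(_ erefl) f0 _].
  (* Only in the pattern A_+ can the isolated value vanish before the perturbation. The open
     triangle then contains no interface, and [dA] vanishes through its factor [f 0]. *)
  have [f00|f0N] := eqVneq (f_ l 0) 0.
    have [a [b [phil fE]]] := lphi_affine k l phiT.
    have tE := tau_tri T k l (@inj_id 'I_3); rewrite /= in tE.
    have interface0 : interface l = set0.
      rewrite tE; apply: (@interface_set0 _ _ _ _ _ phi a b).
      - by rewrite -normr_gt0 -detE normr_gt0 gt_eqF// det_J_gt0.
      - by rewrite -tE; exact: mesh_sub.
      - by rewrite -tE.
      - by rewrite -!fE f00 gt_eqF.
      - by rewrite -!fE f00 mul0r.
      - by rewrite -!fE nmulr_rgt0.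
    have G0 x : G x = 0 by rewrite /G interface0 patch_set0.
    split; first by under eq_fun do rewrite G0; exact: integrable0.
    by rewrite integral0_eq => [|x _]; rewrite ?G0// /dka lA /dA f00 !(mul0r, mulr0).
  have f0p : 0 < f_ l 0 by rewrite lt_def f0N.
  have [||||iG ->] := cellA _ _ f0N _ _ c.
  + exact: lA1.
  + by rewrite detE.
  + by rewrite nmulr_rle0// ltW.
  + by rewrite nmulr_rlt0.
  split; first exact: iG.
  congr EFin; rewrite norm_root_weight ?nmulr_rlt0 ?nmulr_rle0 ?(ltW f0p)// gtr0_sg//.
  rewrite -mulrN dA_identity ?lt_eqF// ?(lt_trans _ f0p)// mul1r.
  by rewrite /dka lA.
- have sP := sign_cellsP hatT lB; rewrite /= ?opprK in sP.
  case: sP => [/pos f1 /neg f2 _ /(_ erefl) f0].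
  have isoN : f_ l 1 != 0 by rewrite gt_eqF.
  have f0iso : f_ l 0 * f_ l 1 <= 0 by rewrite nmulr_rle0// ltW.
  have othiso : f_ l 2 * f_ l 1 < 0 by rewrite nmulr_rlt0.
  have [iG ->] := cellB (nU _ _ _ ab ba' lB) (lB1 lB) dB isoN f0iso othiso c.
  split; first exact: iG.
  have isof0 : f_ l 1 != f_ l 0 by rewrite gt_eqF// (lt_trans f0).
  have othisoN : f_ l 2 != f_ l 1 by rewrite lt_eqF// (lt_trans f2).
  congr EFin; rewrite norm_root_weight// gtr0_sg// dBC_identity// mul1r -mulrN.
  by rewrite /dka (nd _ _ _ ab lB) (nd _ _ _ ba' lB) lB.
- have sP := sign_cellsP hatT lC'; rewrite /= ?opprK in sP.
  case: sP => [/neg f1 /pos f2 _ /(_ erefl) f0].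
  have isoN : f_ l 2 != 0 by rewrite gt_eqF.
  have f0iso : f_ l 0 * f_ l 2 <= 0 by rewrite nmulr_rle0// ltW.
  have othiso : f_ l 1 * f_ l 2 < 0 by rewrite nmulr_rlt0.
  have [iG ->] := cellC (nU _ _ _ ac ca' lC') (nU _ _ _ bc cb' lC') dC isoN f0iso othiso c.
  split; first exact: iG.
  have isof0 : f_ l 2 != f_ l 0 by rewrite gt_eqF// (lt_trans f0).
  have othisoN : f_ l 1 != f_ l 2 by rewrite lt_eqF// (lt_trans f1).
  congr EFin; rewrite norm_root_weight// gtr0_sg// dBC_identity// mul1r -mulrN.
  by rewrite /dka (nd _ _ _ ac lC') (nd _ _ _ ca' lC') (nd _ _ _ bc lC') (nd _ _ _ cb' lC') lC'.
- have sP := sign_cellsP hatT lA'; rewrite /= ?opprK in sP.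
  case: sP => [/pos f1 /pos f2 _ /(_ erefl) f0].
  have f10 : f_ l 1 * f_ l 0 <= 0 by rewrite pmulr_rle0// ltW.
  have f20 : f_ l 2 * f_ l 0 < 0 by rewrite pmulr_rlt0.
  have f0N : f_ l 0 != 0 by rewrite lt_eqF.
  have f1N : f_ l 1 != f_ l 0 by rewrite gt_eqF// (lt_trans f0).
  have f2N : f_ l 2 != f_ l 0 by rewrite gt_eqF// (lt_trans f0).
  have [iG ->] := cellA (lA2 lA') (congr1 _ (esym detE)) f0N f10 f20 c.
  split; first exact: iG.
  congr EFin; rewrite norm_root_weight// ltr0_sg// -mulrN dA_identity// mulN1r.
  by rewrite /dka (nd _ _ _ aa' lA') lA'.
- have sP := sign_cellsP hatT lB'; rewrite /= ?opprK in sP.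
  case: sP => [/neg f1 /pos f2 /(_ erefl) f0 _].
  have isoN : f_ l 1 != 0 by rewrite lt_eqF.
  have f0iso : f_ l 0 * f_ l 1 <= 0 by rewrite mulr_ge0_le0// ltW.
  have othiso : f_ l 2 * f_ l 1 < 0 by rewrite pmulr_rlt0.
  have [iG ->] := cellB (nU _ _ _ ab' a'b' lB') (lB2 lB') dB isoN f0iso othiso c.
  split; first exact: iG.
  have isof0 : f_ l 1 != f_ l 0 by rewrite lt_eqF// (lt_le_trans f1).
  have othisoN : f_ l 2 != f_ l 1 by rewrite gt_eqF// (lt_trans f1).
  congr EFin; rewrite norm_root_weight// ltr0_sg// dBC_identity// mulN1r mulrN opprK.
  by rewrite /dka (nd _ _ _ ab' lB') (nd _ _ _ a'b' lB') (nd _ _ _ bb' lB') lB'.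
- have sP := sign_cellsP hatT lC''; rewrite /= ?opprK in sP.
  case: sP => [/pos f1 /neg f2 /(_ erefl) f0 _].
  have isoN : f_ l 2 != 0 by rewrite lt_eqF.
  have f0iso : f_ l 0 * f_ l 2 <= 0 by rewrite mulr_ge0_le0// ltW.
  have othiso : f_ l 1 * f_ l 2 < 0 by rewrite pmulr_rlt0.
  have [iG ->] := cellC (nU _ _ _ ac' a'c' lC'') (nU _ _ _ bc' b'c' lC'') dC isoN f0iso othiso c.
  split; first exact: iG.
  have isof0 : f_ l 2 != f_ l 0 by rewrite lt_eqF// (lt_le_trans f2).
  have othisoN : f_ l 1 != f_ l 2 by rewrite gt_eqF// (lt_trans f2).
  congr EFin; rewrite norm_root_weight// ltr0_sg// dBC_identity// mulN1r mulrN opprK.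
  by rewrite /dka (nd _ _ _ ac' lC'') (nd _ _ _ a'c' lC'') (nd _ _ _ bc' lC'')
    (nd _ _ _ b'c' lC'') (nd _ _ _ cc' lC'') lC''.
Qed.

(** On the boundary the integrand is pointwise the sum of the cell functions [G l]: in a cut cell
    only one term survives, as open triangles are disjoint, and elsewhere both sides vanish with
    [Vk]. *)
Lemma shape_derivative_volume :
  shape_derivative (fun=> c) (Omega D phi) (Vk T hat phi k) =
    (c * \sum_(l in cut_cells T hat phi k) dka T hat phi k l)%:E.
Proof.
rewrite /shape_derivative integral_mkcond.
pose G l := integrand \_ (interface l).
have GE l x : l \in cut_cells T hat phi k -> tau T l x -> boundary (Omega D phi) x ->
    \sum_(l' in cut_cells T hat phi k) (G l' x)%:E = (integrand x)%:E :> \bar R.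
  move=> lC tx bx; rewrite (bigD1 l)//= big1 ?adde0.
    by rewrite /G patchE mem_set.
  move=> l' /andP[_ ll']; rewrite /G patchE memNset// => -[tx' _].
  by move: ll'; rewrite (tau_unique tx' tx) eqxx.
rewrite [X in integral _ _ X](_ : _ =
    fun x => (\sum_(l in cut_cells T hat phi k) (G l x)%:E)%E); last first.
  apply/funext => x; rewrite patchE; case: ifPn => [|/negP]; rewrite inE => bx.
    have [[l lC tx]|nl] := pselect (exists2 l, l \in cut_cells T hat phi k & tau T l x).
      by rewrite (GE l).
    rewrite Vk_eq0 => [|l lC [tx _]]; last by apply: nl; exists l.
    rewrite dot0v mulr0 big1// => l lC; rewrite /G patchE memNset// => -[tx _].
    by apply: nl; exists l.
  rewrite big1// => l lC; rewrite /G patchE memNset// => -[_].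
  exact: bx.
rewrite integral_sum//; last first.
  (* Integrability is asked at every index, not only over the cut cells; in any other cell [Vk] is
     zero. *)
  move=> l; have [lC|lC] := boolP (l \in cut_cells T hat phi k).
    exact: (integral_cell_dka lC).1.
  rewrite (_ : (fun x => (G l x)%:E) = cst 0%E); first exact: integrable0.
  apply/funext => x; rewrite /G patchE; case: ifPn => // /set_mem[tx bx].
  rewrite Vk_eq0 ?dot0v ?mulr0// => l' l'C [tx' _].
  by move: lC; rewrite (tau_unique tx tx') l'C.
rewrite mulr_sumr -sumEFin; apply: eq_bigr => l lC.
exact: (integral_cell_dka lC).2.
Qed.

End mesh_shape_derivative.

Theorem proposition5p2 (R : realType) (D : set 'cV[R]_2) (M N : nat)
    (T : mesh D M N) (hat : 'I_M -> 'cV[R]_2 -> R)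
    (phi : 'cV[R]_2 -> R) (k : 'I_M) (c1 : R) :
  bounded_polygonal_domain D ->
  hat_basis T hat ->
  S1h T phi ->
  cut_node T phi k ->
  standing_assumption T hat phi k ->
  shape_derivative (fun=> c1) (Omega D phi) (Vk T hat phi k) =
    (c1 * \sum_(l in cut_cells T hat phi k) dka T hat phi k l)%:E.
Proof.
by move=> _ hatT phiT _ std; exact: shape_derivative_volume.
Qed.
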